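(* Let $n\ge1$ be an integer, $s\in(0,1)$ and let $\Omega\subset\mathbb{R}^n$ be a bounded Lipschitz domain. Write $\operatorname{diam}(\Omega):=\sup\{|x-y|:x,y\in\Omega\}$. (i) For every $u\in L^2(\Omega)$, $$0\le\mathcal{E}_-(u,u)\le\frac1{s^2}\,c_{n,s}\,|\mathbb{S}^{n-1}|\,\|u\|_{L^2(\Omega)}^2.$$ (ii) Let $u\in\mathcal{H}^{s+\mathrm{Log}}_0(\Omega)$ and assume $\operatorname{diam}(\Omega)<1$. Then $$\mathcal{E}_+(u,u)-\mathcal{E}_-(u,u)\ \ge\ \frac1s\,c_{n,s}\,|\mathbb{S}^{n-1}|\,\operatorname{diam}(\Omega)^{-2s}\Bigl(\ln\frac1{\operatorname{diam}(\Omega)}-\frac1{2s}\Bigr)\|u\|_{L^2(\Omega)}^2.$$ In particular, if $\operatorname{diam}(\Omega)\le e^{-1/(2s)}$, then $\mathcal{E}_+(u,u)-\mathcal{E}_-(u,u)\ge0$. (iii) Assume that $\operatorname{diam}(\Omega)<e^{-1/(2s)}$ and $b_{n,s}\ge0$. Then $u\mapsto\mathcal{E}_{s+\mathrm{Log}}(u,u)$ is positive definite on $\mathcal{H}^{s+\mathrm{Log}}_0(\Omega)$. Moreover, for every $u\in\mathcal{H}^{s+\mathrm{Log}}_0(\Omega)$ one has $|u|\in\mathcal{H}^{s+\mathrm{Log}}_0(\Omega)$ and $$\mathcal{E}_{s+\mathrm{Log}}(|u|,|u|)\le\mathcal{E}_{s+\mathrm{Log}}(u,u),$$ with equality if and only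 if $u$ does not change sign.
   Context: Functions are real-valued and functions on $\Omega$ are identified with functions on $\mathbb{R}^n$ vanishing a.e. outside $\Omega$. Notation: $a_\pm:=\max\{0,\pm a\}$; $c_{n,s}=2^{2s}\pi^{-n/2}s\frac{\Gamma((n+2s)/2)}{\Gamma(1-s)}$; $b_{n,s}=\ln4+\frac1s+\psi(1-s)+\psi(\frac{n+2s}{2})$ with $\psi=\Gamma'/\Gamma$; $|\mathbb{S}^{n-1}|$ is the surface measure of the unit sphere; $\mathbf{k}_{s+\mathrm{Log},\pm}(z):=c_{n,s}|z|^{-n-2s}(-\ln|z|)_\pm$ for $z\neq0$. Forms: $\mathcal{E}_\pm(u,w):=\iint_{\mathbb{R}^n\times\mathbb{R}^n}(u(x)-u(y))(w(x)-w(y))\,\mathbf{k}_{s+\mathrm{Log},\pm}(x-y)\,dx\,dy$, $\mathcal{E}_s(u,w):=\iint_{\mathbb{R}^n\times\mathbb{R}^n}(u(x)-u(y))(w(x)-w(y))|x-y|^{-n-2s}\,dx\,dy$, and $\mathcal{E}_{s+\mathrm{Log}}(u,w):=\mathcal{E}_+(u,w)-\mathcal{E}_-(u,w)+\frac{b_{n,s}c_{n,s}}{2}\mathcal{E}_s(u,w)$. Space: $\mathcal{H}^{s+\mathrm{Log}}_0(\Omega):=\{u\in L^2(\mathbb{R}^n):\mathcal{E}_+(u,u)<\infty,\ u=0\text{ a.e. in }\Omega^c\}$. *)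

(* Defs.v *)
From HB Require Import structures.
From mathcomp Require Import all_boot all_order all_algebra.
From mathcomp Require Import all_classical all_reals all_analysis.

Set Implicit Arguments.
Unset Strict Implicit.
Unset Printing Implicit Defensive.

Import Order.TTheory GRing.Theory Num.Theory.
Import numFieldNormedType.Exports.

Local Open Scope classical_set_scope.
Local Open Scope ring_scope.

(* R^n is 'rV[R]_n with the library's (product) topology.  Its sigma-algebra is
   the one generated by the coordinates, i.e. the product of the Borel
   sigma-algebras of R, and Lebesgue measure is the n-fold product measure. *)

Definition measure_rV_display : measure_display -> measure_display.
Proof. exact. Qed.

Section measurable_rV.
Context {R : realType}.
Variable n : nat.

Definition coord_rV (i : 'I_n) (v : 'rV[R]_n) : R := v ord0 i.

Let rV_set0 : g_sigma_preimage coord_rV set0.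
Proof. exact: sigma_algebra0. Qed.

Let rV_setC A : g_sigma_preimage coord_rV A -> g_sigma_preimage coord_rV (~` A).
Proof. exact: sigma_algebraC. Qed.

Let rV_bigcup (F : _^nat) : (forall i, g_sigma_preimage coord_rV (F i)) ->
  g_sigma_preimage coord_rV (\bigcup_i (F i)).
Proof. exact: sigma_algebra_bigcup. Qed.

HB.instance Definition _ := @isMeasurable.Build (measure_rV_display default_measure_display)
  'rV[R]_n (g_sigma_preimage coord_rV) rV_set0 rV_setC rV_bigcup.

End measurable_rV.

Lemma measurable_coord_rV (R : realType) n (i : 'I_n) :
  measurable_fun [set: 'rV[R]_n] (fun v : 'rV[R]_n => v ord0 i).
Proof.
move=> _ Y mY; rewrite setTI; apply: sub_sigma_algebra => /=.
rewrite -bigcup_seq/=; exists i => /=; first by rewrite mem_index_enum.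
by exists Y => //; rewrite setTI.
Qed.

Lemma measurable_fun_rVP d (T : measurableType d) (R : realType) n
    (f : T -> 'rV[R]_n) :
  (forall i, measurable_fun [set: T] (fun x => f x ord0 i)) ->
  measurable_fun [set: T] f.
Proof.
move=> mf _ A; rewrite setTI.
have -> : measurable A = g_sigma_preimage (@coord_rV R n) A by [].
move=> mA.
suff : g_sigma_preimage (fun i => @coord_rV R n i \o f) `<=` measurable.
  by apply; rewrite g_sigma_preimage_comp; exists A => //; rewrite setTI.
apply: smallest_sub; first exact: sigma_algebra_measurable.
move=> B; rewrite -bigcup_seq/= => -[i _ [C mC <-]].
exact: mf.
Qed.

Definition cons_rV (R : realType) n (p : R * 'rV[R]_n) : 'rV[R]_n.+1 :=
  row_mx (const_mx p.1 : 'rV_1) p.2.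

Lemma cons_rVEl (R : realType) n (p : R * 'rV[R]_n) (j : 'I_1) :
  cons_rV p ord0 (lshift n j) = p.1.
Proof. by apply: etrans (row_mxEl _ _ _ _) _; rewrite mxE. Qed.

Lemma cons_rVEr (R : realType) n (p : R * 'rV[R]_n) (j : 'I_n) :
  cons_rV p ord0 (rshift 1 j) = p.2 ord0 j.
Proof. exact: row_mxEr. Qed.

Lemma measurable_cons_rV (R : realType) n :
  measurable_fun [set: R * 'rV[R]_n] (@cons_rV R n).
Proof.
apply: measurable_fun_rVP => i.
rewrite -(@splitK 1 n i); case: (@fintype.split 1 n i) => j.
  rewrite [X in measurable_fun _ X](_ : _ = fst); first exact: measurable_fst.
  by apply/funext => p; exact: cons_rVEl.
rewrite [X in measurable_fun _ X](_ : _ = (fun v : 'rV[R]_n => v ord0 j) \o snd).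
  by apply: measurableT_comp; [exact: measurable_coord_rV|exact: measurable_snd].
by apply/funext => p; exact: cons_rVEr.
Qed.

Section lebesgue_rV_step.
Context {R : realType}.
Variables (n : nat) (m : {sigma_finite_measure set 'rV[R]_n -> \bar R}).

Definition lebesgue_rV_succ : set 'rV[R]_n.+1 -> \bar R :=
  pushforward (@lebesgue_measure R \x m)%E (@cons_rV R n).

Let succ0 : lebesgue_rV_succ set0 = 0%E.
Proof. by rewrite /lebesgue_rV_succ /pushforward preimage_set0 measure0. Qed.

Let succ_ge0 A : (0 <= lebesgue_rV_succ A)%E.
Proof. by rewrite /lebesgue_rV_succ /pushforward; apply: measure_ge0. Qed.

Let succ_sigma_additive : semi_sigma_additive lebesgue_rV_succ.
Proof.
move=> F mF tF mUF; rewrite /lebesgue_rV_succ /pushforward preimage_bigcup.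
have mcons A : measurable A -> measurable (@cons_rV R n @^-1` A).
  by move=> mA; rewrite -[X in measurable X]setTI; exact: measurable_cons_rV.
apply: measure_semi_sigma_additive.
- by move=> k; exact: mcons.
- apply/trivIsetP => /= i j _ _ ij; rewrite -preimage_setI.
  by move/trivIsetP : tF => /(_ _ _ _ _ ij) ->//; rewrite preimage_set0.
- by rewrite -preimage_bigcup; exact: mcons.
Qed.

HB.instance Definition _ := isMeasure.Build _ _ _ lebesgue_rV_succ
  succ0 succ_ge0 succ_sigma_additive.

Let uncons_rV (v : 'rV[R]_n.+1) : R * 'rV[R]_n :=
  (v ord0 ord0, @rsubmx _ 1 1 n v).

Let measurable_uncons_rV : measurable_fun [set: 'rV[R]_n.+1] uncons_rV.
Proof.
apply: measurable_fun_pair => /=; first exact: measurable_coord_rV.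
apply: measurable_fun_rVP => i; under eq_fun do rewrite mxE.
exact: measurable_coord_rV.
Qed.

Let cons_rVK : cancel (@cons_rV R n) uncons_rV.
Proof.
move=> [x v]; rewrite /uncons_rV /cons_rV /=; congr (_, _).
  rewrite -[RHS](cons_rVEl (x, v) ord0); congr (fun_of_matrix _ _ _).
  exact: val_inj.
exact: row_mxKr.
Qed.

Let sigma_finite_succ : sigma_finite setT lebesgue_rV_succ.
Proof.
have /sigma_finiteP[F [TF ndF Foo]] := sigma_finiteT (@lebesgue_measure R).
have /sigma_finiteP[G [TG ndG Goo]] := sigma_finiteT m.
exists (fun k => uncons_rV @^-1` (F k `*` G k)).
  rewrite -preimage_bigcup (_ : \bigcup_k _ = setT) ?preimage_setT//.
  rewrite -setXTT TF TG predeqE => -[x y]; split.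
    by move=> [k _ []/= ? ?]; split; exists k.
  move=> [/= [k _ Fkx] [l _ Gly]]; exists (maxn k l) => //; split.
  - by move: x Fkx; exact/subsetPset/ndF/leq_maxl.
  - by move: y Gly; exact/subsetPset/ndG/leq_maxr.
move=> k; have [mFk Fkoo] := Foo k; have [mGk Gkoo] := Goo k; split.
  rewrite -[X in measurable X]setTI; apply: measurable_uncons_rV => //.
  exact: measurableX.
rewrite /lebesgue_rV_succ /pushforward -comp_preimage.
rewrite (_ : _ \o _ = id); last by apply/funext => z; exact: cons_rVK.
by rewrite preimage_id product_measure1E// lte_mul_pinfty// ge0_fin_numE.
Qed.

HB.instance Definition _ := Measure_isSigmaFinite.Build _ _ _
  lebesgue_rV_succ sigma_finite_succ.

End lebesgue_rV_step.

Fixpoint lebesgue_rV (R : realType) (n : nat) :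
    {sigma_finite_measure set 'rV[R]_n -> \bar R} :=
  if n is n'.+1 then lebesgue_rV_succ (lebesgue_rV R n')
  else @dirac _ 'rV[R]_0 0 R.

Section euclidean.
Context {R : realType} {n : nat}.
Implicit Types (x y : 'rV[R]_n) (Omega : set 'rV[R]_n).

Definition dotv x y : R := \sum_(i < n) x ord0 i * y ord0 i.

(* The library's norm `|x| on 'rV[R]_n is the sup norm. *)
Definition enorm x : R := Num.sqrt (dotv x x).

Definition diam Omega : R :=
  sup [set enorm (p.1 - p.2) | p in Omega `*` Omega].

(* Near each boundary point, and in suitable orthonormal coordinates, Omega is
   the strict epigraph of a Lipschitz function: e is the vertical direction,
   and phi only matters on the hyperplane orthogonal to e. *)
Definition lipschitz_domain Omega : Prop :=
  [/\ Omega !=set0, open Omega, connected Omega &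
    forall x0, (closure Omega `\` interior Omega) x0 ->
      exists (r : R) (e : 'rV[R]_n) (phi : 'rV[R]_n -> R) (L : R),
      [/\ 0 < r, enorm e = 1,
          forall y z, dotv y e = 0 -> dotv z e = 0 ->
            `|phi y - phi z| <= L * enorm (y - z) &
          forall x, enorm (x - x0) < r ->
            (Omega x <-> phi (x - dotv x e *: e) < dotv x e)]].

Definition unit_sphere : set 'rV[R]_n := [set x | enorm x = 1].

(* The surface measure of A included in the unit sphere is n times the volume
   of the truncated cone over A. *)
Definition sphere_measure (A : set 'rV[R]_n) : \bar R :=
  let cone := [set r *: t | r in [set r : R | 0 < r <= 1] & t in A] in
  (n%:R%:E * lebesgue_rV R n cone)%E.

Definition sphere_area : R := fine (sphere_measure unit_sphere).

End euclidean.
Arguments sphere_area R n : clear implicits.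

Section constants.
Context {R : realType}.

(* Meaningful for x > 0, the only arguments used below. *)
Definition Gamma (x : R) : R :=
  \int[@lebesgue_measure R]_(t in `]0, +oo[) (t `^ (x - 1) * expR (- t)).

Definition digamma (x : R) : R := derive1 Gamma x / Gamma x.

Definition cns (n : nat) (s : R) : R :=
  2 `^ (2 * s) * pi `^ (- (n%:R / 2)) * s *
  (Gamma ((n%:R + 2 * s) / 2) / Gamma (1 - s)).

Definition bns (n : nat) (s : R) : R :=
  ln 4 + s^-1 + digamma (1 - s) + digamma ((n%:R + 2 * s) / 2).

Definition pos_part (a : R) : R := Num.max 0 a.
Definition neg_part (a : R) : R := Num.max 0 (- a).

End constants.

Section forms.
Context {R : realType} {n : nat}.
Implicit Types (s : R) (z : 'rV[R]_n) (u w : 'rV[R]_n -> R).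

(* 0 `^ a = 0 for a != 0, so all three kernels are 0 at z = 0, where the
   mathematical kernels are undefined; this only affects the null diagonal. *)
Definition kers s z : R := enorm z `^ (- n%:R - 2 * s).
Definition kerp s z : R := cns n s * kers s z * pos_part (- ln (enorm z)).
Definition kerm s z : R := cns n s * kers s z * neg_part (- ln (enorm z)).

Definition kernel_form (k : 'rV[R]_n -> R) u w : \bar R :=
  (\int[lebesgue_rV R n \x lebesgue_rV R n]_p
     ((u p.1 - u p.2) * (w p.1 - w p.2) * k (p.1 - p.2))%:E)%E.

Definition Es s u w : \bar R := kernel_form (kers s) u w.
Definition Ep s u w : \bar R := kernel_form (kerp s) u w.
Definition Em s u w : \bar R := kernel_form (kerm s) u w.
Definition EsLog s u w : \bar R :=
  (Ep s u w - Em s u w + (bns n s * cns n s / 2)%:E * Es s u w)%E.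

End forms.

Section spaces.
Context {R : realType} {n : nat}.
Implicit Types (Omega : set 'rV[R]_n) (u : 'rV[R]_n -> R).
Local Notation mu := (lebesgue_rV R n).

(* A function on Omega is identified with a function on R^n that vanishes a.e.
   outside Omega. *)
Definition L2 Omega : set ('rV[R]_n -> R) :=
  [set u | u \in Lfun mu 2%:E /\ {ae mu, forall x, ~ Omega x -> u x = 0}].

Definition L2norm Omega u : \bar R := ('N[mu]_2%:E[(EFin \o u) \_ Omega])%E.

Definition HsLog0 (s : R) Omega : set ('rV[R]_n -> R) :=
  [set u | [/\ u \in Lfun mu 2%:E, (Ep s u u < +oo)%E &
               {ae mu, forall x, (~` Omega) x -> u x = 0}]].

Definition keeps_sign u : Prop :=
  {ae mu, forall x, 0 <= u x} \/ {ae mu, forall x, u x <= 0}.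

Definition positive_definite_on (V : set ('rV[R]_n -> R))
    (Q : ('rV[R]_n -> R) -> \bar R) : Prop :=
  forall u, V u -> ~ {ae mu, forall x, u x = 0} -> (0 < Q u)%E.

End spaces.

(* Main.v *)
Require Import Defs.
From mathcomp Require Import all_boot all_order all_algebra.
From mathcomp Require Import all_classical all_reals all_analysis.
From mathcomp Require Import measurable_realfun ring lra.

(** Write [c] for [cns n s], [S] for [sphere_area R n] and [d] for [diam Omega].
For a nonnegative kernel [k], Tonelli's theorem and the invariance of Lebesgue
measure under [y |-> x - y] give
  [\iint (u(x)^2 + u(y)^2) k(x-y) dx dy = 2 |u|_2^2 \int k]
([integral_sqr_sum_kernel]); the proof consists in comparing
[(u(x) - u(y))^2] with [u(x)^2 + u(y)^2].

(i) Always [(a - b)^2 <= 2 (a^2 + b^2)], so [E_-(u,u) <= 4 |u|_2^2 \int k_-]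
([kernel_form_le_L2]), and [\int k_- = c S / (4 s^2)] ([integral_kerm]).

(ii) If [u] vanishes off [Omega] then [u(x) u(y) = 0] as soon as [|x - y| > d],
and there [(u(x) - u(y))^2 = u(x)^2 + u(y)^2].  As [k_-] lives on
[|z| > 1 > d], [E_-(u,u)] equals [2 |u|_2^2 \int k_-] ([EmE]), and keeping only
the part [|z| > d] of [k_+] gives
[E_+(u,u) >= 2 |u|_2^2 \int_{|z|>d} k_+] ([Ep_ge]).  The difference of the two
integrals is elementary ([integral_kerm], [integral_kerp_far]); it is positive
when [d < exp(-1/(2s))].

(iii) Positive definiteness is (ii) together with [b_{n,s} E_s >= 0].  Replacing [u] by
[|u|] decreases [(u(x) - u(y))^2], hence [E_+] and [E_s], whereas [E_-], being a
multiple of [|u|_2^2], does not change.  If [E_{s+Log}] does not change either,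
then neither does [E_+], since all three forms are finite on the space
([Es_fin_num], [Em_fin]); but [E_+(u,u) - E_+(|u|,|u|)] is the integral of
[2 (|u(x) u(y)| - u(x) u(y)) k_+(x-y)], whose integrand is positive on
[{u > 0} x {u < 0}] because [0 < |x - y| < 1] there.  One of these two sets is
therefore null ([kernel_form_abs_eq_sign]).

The kernels are integrated without polar coordinates: the scaling
[|{|v| <= r}| = r^n |{|v| <= 1}|] says that [v |-> |v|^n] transports Lebesgue
measure of R^n to a multiple of Lebesgue measure of the half-line
([ge0_integral_enormXn]).  Finally [c > 0] requires the Gamma integral to
converge ([Gamma_gt0]). *)

Import Order.TTheory GRing.Theory Num.Theory.
Import numFieldNormedType.Exports.

Local Open Scope classical_set_scope.
Local Open Scope ring_scope.

(** * Affine changes of variables in R^n *)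

Lemma measurable_affine (R : realType) (a b : R) :
  measurable_fun setT (fun x : R => a * x + b).
Proof. by apply: measurable_funD => //; exact: measurable_funM. Qed.

(** Both sides are measures in [A], so half-open intervals suffice; the sign of
[a] decides which end of the preimage is open. *)
Lemma lebesgue_measure_affine (R : realType) (a b : R) (A : set R) :
  a != 0 -> measurable A ->
  lebesgue_measure ((fun x => a * x + b) @^-1` A) =
  (`|a|^-1%:E * lebesgue_measure A)%E.
Proof.
move=> a0 mA.
have ma0 : 0 <= `|a| by [].
pose f := fun x : measurableTypeR R => (a * x + b : measurableTypeR R).
have mf : measurable_fun setT f by exact: measurable_affine.
suff -> : lebesgue_measure A = mscale (NngNum ma0) (pushforward lebesgue_measure f) A.
  by rewrite /mscale /= muleA -EFinM mulVf ?normr_eq0// mul1e.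
move=> m.
apply: lebesgue_measure_unique => //= _ [[c d]] _ <-.
rewrite /mscale/= /pushforward.
have [ag0|al0|/eqP] := ltgtP a 0; last by rewrite (negbTE a0).
- rewrite (_ : f @^-1` _ = `[(d - b) / a, (c - b) / a[%classic); last first.
    apply/seteqP; split=> x /=; rewrite !in_itv/= /f ler_ndivrMr// ltr_ndivlMr//;
    rewrite lerBrDr ltrBlDr mulrC; lra.
  rewrite !lebesgue_measure_itv/= !lte_fin ltr_nM2r ?invr_lt0// ltrD2r.
  case: ifPn => cd; last by rewrite mule0.
  by rewrite -!EFinB -EFinM ltr0_norm//; congr EFin; field.
- rewrite (_ : f @^-1` _ = `](c - b) / a, (d - b) / a]%classic); last first.
    apply/seteqP; split=> x /=; rewrite !in_itv/= /f ler_pdivlMr// ltr_pdivrMr//;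
    rewrite lerBrDr ltrBlDr mulrC; lra.
  rewrite !lebesgue_measure_itv/= !lte_fin ltr_pM2r ?invr_gt0// ltrD2r.
  case: ifPn => cd; last by rewrite mule0.
  by rewrite -!EFinB -EFinM gtr0_norm//; congr EFin; field.
Qed.

Lemma ge0_integral_affine (R : realType) (a b : R) (f : R -> \bar R) :
  a != 0 -> measurable_fun setT f -> (forall x, 0 <= f x)%E ->
  (\int[lebesgue_measure]_x f (a * x + b)%R =
   `|a|^-1%:E * \int[lebesgue_measure]_x f x)%E.
Proof.
move=> a0 mf f0.
have ma0 : 0 <= `|a|^-1 by rewrite invr_ge0.
pose g := fun x : measurableTypeR R => (a * x + b : measurableTypeR R).
have mg : measurable_fun setT g by exact: measurable_affine.
rewrite -(ge0_integral_mscale _ _ (NngNum ma0))//.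
transitivity (\int[pushforward lebesgue_measure g]_x f x)%E.
  by rewrite ge0_integral_pushforward.
apply: eq_measure_integral => // A mA _.
by rewrite /mscale/= /pushforward lebesgue_measure_affine.
Qed.

Lemma measurable_rV_affine (R : realType) n (a : R) (b : 'rV[R]_n) :
  measurable_fun setT (fun v : 'rV[R]_n => a *: v + b).
Proof.
apply: measurable_fun_rVP => i; under eq_fun do rewrite !mxE.
apply: measurable_funD => //; apply: measurable_funM => //.
exact: measurable_coord_rV.
Qed.

Lemma ge0_integral_rV_succ (R : realType) n (f : 'rV[R]_n.+1 -> \bar R) :
  measurable_fun setT f -> (forall v, 0 <= f v)%E ->
  (\int[lebesgue_rV R n.+1]_v f v =
   \int[lebesgue_measure]_x \int[lebesgue_rV R n]_v f (cons_rV (x, v)))%E.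
Proof.
move=> mf f0.
have mc := @measurable_cons_rV R n.
transitivity (\int[(@lebesgue_measure R \x lebesgue_rV R n)%E]_p f (cons_rV p))%E.
  rewrite /=; symmetry; apply: etrans; last first.
    apply/esym/(@ge0_integral_pushforward _ _ (measurableTypeR R * 'rV[R]_n)%type _ R _ mc (@lebesgue_measure R \x lebesgue_rV R n)%E setT f measurableT mf) => //.
  by rewrite preimage_setT.
apply: (fubini_tonelli1 (m1 := @lebesgue_measure R) (fun p => f (cons_rV p))) => //.
exact: measurableT_comp.
Qed.

(** Induction on [n]: Tonelli splits off the first coordinate, and each coordinate
contributes a factor [|a|^-1].  With [a = -1] and [a = 1] this is the invariance
under [y |-> x - y] and [x |-> x - y], with [a > 0] the scaling of volumes. *)
Lemma ge0_integral_rV_affine (R : realType) n (a : R) (b : 'rV[R]_n)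
    (f : 'rV[R]_n -> \bar R) :
  a != 0 -> measurable_fun setT f -> (forall v, 0 <= f v)%E ->
  (\int[lebesgue_rV R n]_v f (a *: v + b)%R =
   (`|a| ^- n)%:E * \int[lebesgue_rV R n]_v f v)%E.
Proof.
move=> a0; elim: n b f => [|n IHn] b f mf f0.
  rewrite expr0 invr1 mul1e; apply: eq_integral => v _.
  by rewrite [in LHS]thinmx0 [in RHS]thinmx0.
rewrite (ge0_integral_rV_succ _ _ (fun v => f (a *: v + b))); last 2 first.
- exact: (measurableT_comp mf (measurable_rV_affine _ _ _ _)).
- by [].
have mc := @measurable_cons_rV R n.
have mF : measurable_fun setT (f \o @cons_rV R n) by exact: measurableT_comp.
pose F x := (\int[lebesgue_rV R n]_v f (cons_rV (x, v)))%E.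
have mF1 : measurable_fun setT F.
  by apply: (measurable_fun_fubini_tonelli_F (f \o @cons_rV R n)) => // p; exact: f0.
have F0 x : (0 <= F x)%E by exact: integral_ge0.
transitivity (\int[lebesgue_measure]_x ((`|a| ^- n)%:E * F (a * x + b ord0 ord0)%R))%E.
  apply: eq_integral => x _.
  pose b' := @rsubmx _ 1 1 n b.
  have E v : a *: cons_rV (x, v) + b = cons_rV (a * x + b ord0 ord0, a *: v + b').
    apply/rowP => i; rewrite -(@splitK 1 n i) 2!mxE.
    case: (@fintype.split 1 n i) => k /=.
      rewrite (cons_rVEl (x, v)) (cons_rVEl (_, _)) /= ord1.
      by congr (_ + b _ _); apply/val_inj.
    by rewrite (cons_rVEr (x, v)) (cons_rVEr (_, _)) /= !mxE.
  under eq_integral do rewrite E.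
  rewrite (IHn b' (fun v => f (cons_rV (a * x + b ord0 ord0, v))))//.
  apply: (measurableT_comp mF); exact: pair1_measurable.
rewrite ge0_integralZl//; last first.
  exact: (measurableT_comp mF1 (measurable_affine _ _ _)).
rewrite ge0_integral_affine// muleA -EFinM -invfM -exprSr.
by rewrite -ge0_integral_rV_succ.
Qed.

(** * The Euclidean norm and the volume of balls *)

Section enorm_theory.
Context {R : realType} {n : nat}.
Implicit Types (v w : 'rV[R]_n).

Lemma enorm_ge0 v : 0 <= enorm v.
Proof. exact: sqrtr_ge0. Qed.

Lemma enormZ a v : enorm (a *: v) = `|a| * enorm v.
Proof.
rewrite /enorm -sqrtr_sqr -sqrtrM ?sqr_ge0//; congr Num.sqrt.
by rewrite /dotv mulr_sumr; apply: eq_bigr => i _; rewrite !mxE expr2 mulrACA.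
Qed.


Lemma coord_le_enorm v i : `|v ord0 i| <= enorm v.
Proof.
rewrite -sqrtr_sqr ler_wsqrtr// /dotv (bigD1 i)//= expr2 lerDl.
by apply: sumr_ge0 => j _; rewrite -expr2 sqr_ge0.
Qed.

Lemma enorm_eq0 v : (enorm v == 0) = (v == 0).
Proof.
apply/eqP/eqP => [v0|->]; last first.
  by rewrite -(scale0r (0 : 'rV[R]_n)) enormZ normr0 mul0r.
apply/rowP => i; rewrite mxE; apply/eqP; rewrite -normr_le0 -v0.
exact: coord_le_enorm.
Qed.

Lemma enorm_le_cube v r : (forall i, `|v ord0 i| <= r) -> enorm v <= n%:R * r.
Proof.
case: n v => [|m] v vr; first by rewrite mul0r /enorm /dotv big_ord0 sqrtr0.
have r0 : 0 <= r by rewrite (le_trans _ (vr ord0)).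
rewrite -[leRHS]ger0_norm ?mulr_ge0// -sqrtr_sqr ler_wsqrtr//.
apply: (@le_trans _ _ (m.+1%:R * r ^+ 2)).
  rewrite mulr_natl -[m.+1 in leRHS]card_ord -sumr_const; apply: ler_sum => i _.
  by rewrite -expr2 -real_normK ?num_real// ler_pXn2r// nnegrE.
by rewrite exprMn ler_wpM2r ?sqr_ge0// expr2 ler_peMl ?ler1n.
Qed.

Lemma measurable_enorm : measurable_fun setT (@enorm R n).
Proof.
apply: (measurableT_comp (continuous_measurable_fun (@sqrt_continuous R))).
apply: measurable_sum => i.
by apply: measurable_funM; exact: measurable_coord_rV.
Qed.

End enorm_theory.

Section volume.
Context {R : realType}.

Definition cube n (r : R) : set 'rV[R]_n := [set v | forall i, `|v ord0 i| <= r].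

Lemma measurable_cube n r : measurable (cube n r).
Proof.
rewrite (_ : cube n r = \bigcap_(i in [set: 'I_n]) ((fun v => v ord0 i) @^-1` `[- r, r])).
  apply: fin_bigcap_measurable => // i _.
  by rewrite -[X in measurable X]setTI; exact: measurable_coord_rV.
by apply/seteqP; split=> v /= vr i; [move=> _|]; have := vr i;
  rewrite /= ?in_itv/= ler_norml//; exact.
Qed.

Lemma volume_cube n r : 0 <= r -> lebesgue_rV R n (cube n r) = ((2 * r) ^+ n)%:E.
Proof.
move=> r0; elim: n => [|n IHn].
  by rewrite expr0 /= diracE mem_set//= => -[].
transitivity ((@lebesgue_measure R \x lebesgue_rV R n)%E (`[- r, r] `*` cube n r)).
  rewrite /= /lebesgue_rV_succ /pushforward; congr (_ _).
  apply/seteqP; split=> [p /= pr|p [/= xr vr] i].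
    split=> /=; first by have := pr (@lshift 1 n ord0); rewrite cons_rVEl in_itv/= ler_norml.
    by move=> i; have := pr (@rshift 1 n i); rewrite cons_rVEr.
  rewrite -(@splitK 1 n i); case: (@fintype.split 1 n i) => k /=.
    by rewrite cons_rVEl; move: xr; rewrite in_itv/= ler_norml.
  by rewrite cons_rVEr.
rewrite product_measure1E//; last exact: measurable_cube.
rewrite IHn/= lebesgue_measure_itv/= lte_fin exprS EFinM; congr (_ * _)%E.
have [r0'|] := ltP (- r) r; first by rewrite -EFinB opprK; congr EFin; ring.
by move=> rr; have -> : r = 0 by [lra]; rewrite mulr0.
Qed.

Definition unit_ball n : set 'rV[R]_n := [set v | enorm v <= 1].

Lemma measurable_ball_enorm n (r : R) : measurable [set v : 'rV[R]_n | enorm v <= r].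
Proof.
rewrite (_ : [set v | _] = @enorm R n @^-1` `]-oo, r]).
  by rewrite -[X in measurable X]setTI; exact: measurable_enorm.
by apply/seteqP; split=> v /=; rewrite in_itv.
Qed.

(** Real-valued because the unit ball lies in a cube; see [ball_volumeE]. *)
Definition ball_volume n : R := fine (lebesgue_rV R n (unit_ball n)).

Lemma ball_volumeE n : lebesgue_rV R n (unit_ball n) = (ball_volume n)%:E.
Proof.
rewrite /ball_volume fineK// ge0_fin_numE//.
apply: (@le_lt_trans _ _ (lebesgue_rV R n (cube n 1))).
  apply: le_measure; rewrite ?inE.
  - exact: measurable_ball_enorm.
  - exact: measurable_cube.
  - by move=> v /= v1 i; rewrite (le_trans (coord_le_enorm _ _)).
by rewrite volume_cube// ltry.
Qed.

(** The cube of half-side [1 / (n + 1)] fits in the unit ball; [n + 1] rather than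
[n] avoids a case distinction at [n = 0]. *)
Lemma ball_volume_gt0 n : 0 < ball_volume n.
Proof.
rewrite -lte_fin -ball_volumeE.
have ? : 0 < n.+1%:R^-1 :> R by rewrite invr_gt0.
apply: (@lt_le_trans _ _ (lebesgue_rV R n (cube n n.+1%:R^-1))).
  by rewrite volume_cube ?ltW// lte_fin exprn_gt0// mulr_gt0.
apply: le_measure; rewrite ?inE.
- exact: measurable_cube.
- exact: measurable_ball_enorm.
move=> v vn; apply: (le_trans (enorm_le_cube _ _ vn)).
by rewrite ler_pdivrMr// mul1r ler_nat.
Qed.

(** A positive radius is the scaling of the unit ball.  At [r = 0] the ball is a
cube of side [0], which is null since [0 < n]. *)
Lemma volume_ball n (r : R) : (0 < n)%N -> 0 <= r ->
  lebesgue_rV R n [set v | enorm v <= r] = (r ^+ n * ball_volume n)%:E.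
Proof.
move=> n0; rewrite le_eqVlt => /predU1P[<-|r0].
  rewrite expr0n gtn_eqF// mul0r; apply/eqP; rewrite eq_le measure_ge0 andbT.
  have <- : lebesgue_rV R n (cube n 0) = 0%:E.
    by rewrite volume_cube// mulr0 expr0n gtn_eqF.
  apply: le_measure; rewrite ?inE.
  - exact: measurable_ball_enorm.
  - exact: measurable_cube.
  - by move=> v /= v1 i; rewrite (le_trans (coord_le_enorm _ _)).
have rV0 : r^-1 != 0 by rewrite invr_neq0// gt_eqF.
have mB := measurable_ball_enorm n 1.
have := @ge0_integral_rV_affine R n r^-1 0 (EFin \o \1_(unit_ball n)) rV0.
have -> : (fun v => (EFin \o \1_(unit_ball n)) (r^-1 *: v + 0)) =
    (fun v => (\1_[set v : 'rV[R]_n | enorm v <= r] v : R)%:E).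
  apply/funext => v /=; rewrite addr0 !indicE; congr ((nat_of_bool _)%:R%:E).
  apply/idP/idP => /set_mem/= h; apply/mem_set => /=; move: h;
  by rewrite /unit_ball/= enormZ gtr0_norm ?invr_gt0// ler_pdivrMl// mulr1.
rewrite !integral_indic ?setIT//; last exact: measurable_ball_enorm.
rewrite gtr0_norm ?invr_gt0// -exprVn invrK EFinM => ->.
- by congr (_ * _)%E; exact: ball_volumeE.
- exact/measurable_EFinP.
- by move=> v /=; rewrite lee_fin.
Qed.

Lemma ball_enorm0 n : [set v : 'rV[R]_n | enorm v <= 0] = [set 0].
Proof.
apply/seteqP; split=> v /=; last by move=> ->; rewrite le_eqVlt enorm_eq0 eqxx.
by move=> v0; apply/eqP; rewrite -enorm_eq0 eq_le v0 enorm_ge0.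
Qed.

Lemma volume0 n : (0 < n)%N -> lebesgue_rV R n [set 0] = 0%E.
Proof.
move=> n0.
by rewrite -ball_enorm0 volume_ball// expr0n gtn_eqF// mul0r.
Qed.

End volume.

(** * Integration of radial functions *)

Section radial.
Context {R : realType}.
Variable n : nat.
Hypothesis n0 : (0 < n)%N.

(** The truncated cone over the whole sphere is the unit ball without its centre. *)
Lemma sphere_areaE : sphere_area R n = n%:R * ball_volume n.
Proof.
rewrite /sphere_area /sphere_measure.
set A := [set _ | _ in _ & _ in _].
have AE : A = unit_ball n `\` [set 0].
  apply/seteqP; split=> v.
    move=> [r /= /andP[r0 r1] [t /= t1 <-]]; split; rewrite /unit_ball/=.
      by rewrite enormZ t1 mulr1 gtr0_norm.
    by apply/eqP; rewrite -enorm_eq0 enormZ t1 mulr1 normr_eq0 gt_eqF.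
  move=> [/= v1 /eqP vn0]; have v0 : 0 < enorm v by rewrite lt0r enorm_eq0 vn0 enorm_ge0.
  exists (enorm v) => /=; first by rewrite v0.
  exists ((enorm v)^-1 *: v); last by rewrite scalerA divff ?gt_eqF// scale1r.
  by rewrite /unit_sphere/= enormZ gtr0_norm ?invr_gt0// mulVf// gt_eqF.
have m0 : measurable [set (0 : 'rV[R]_n)].
  by rewrite -ball_enorm0; exact: measurable_ball_enorm.
suff -> : lebesgue_rV R n A = (ball_volume n)%:E by [].
rewrite AE -ball_volumeE.
rewrite -[in RHS](setDUK (_ : [set 0] `<=` @unit_ball R n)); last first.
  by move=> _ ->; rewrite /unit_ball/= (_ : enorm 0 = 0)//; apply/eqP; rewrite enorm_eq0.
rewrite measureU//=; last 2 first.
- by apply: measurableD => //; exact: measurable_ball_enorm.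
- by rewrite setDIK.
by rewrite [X in (X + _)%E](volume0 n n0) add0e.
Qed.

Let phi (v : 'rV[R]_n) : measurableTypeR R := enorm v ^+ n.

Let mphi : measurable_fun setT phi.
Proof. by apply: measurable_funX; exact: measurable_enorm. Qed.

Let volume_phi_le (t : R) :
  lebesgue_rV R n [set v : 'rV[R]_n | enorm v ^+ n <= t] = (Num.max t 0 * ball_volume n)%:E.
Proof.
have nn0 : n%:R != 0 :> R by rewrite pnatr_eq0 -lt0n.
have [t0|t0] := leP 0 t; last first.
  rewrite mul0r (_ : [set v | _] = set0) ?measure0//.
  apply/seteqP; split=> v //= vt.
  by have := lt_le_trans t0 (exprn_ge0 n (enorm_ge0 v)); rewrite ltNge vt.
rewrite (_ : [set v | _] = [set v | enorm v <= t `^ n%:R^-1]); last first.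
  suff tE : (t `^ n%:R^-1) ^+ n = t.
    apply/funext => v /=; rewrite -[in LHS]tE.
    by rewrite ler_pXn2r// nnegrE ?enorm_ge0 ?powR_ge0.
  by rewrite -powR_mulrn ?powR_ge0// -powRrM mulVf// powRr1.
by rewrite volume_ball ?powR_ge0// -powR_mulrn ?powR_ge0// -powRrM mulVf// powRr1.
Qed.

Let phi_ge0 v : 0 <= phi v. Proof. by rewrite exprn_ge0// enorm_ge0. Qed.

Let volume_phi_itv (c d : R) : c <= d ->
  pushforward (lebesgue_rV R n) phi (`]c, d]%classic : set (measurableTypeR R)) =
  ((Num.max d 0 - Num.max c 0) * ball_volume n)%:E.
Proof.
move=> cd; rewrite /pushforward.
have mle (t : R) : measurable [set v : 'rV[R]_n | enorm v ^+ n <= t].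
  rewrite (_ : [set v | _] = phi @^-1` `]-oo, t]).
    by rewrite -[X in measurable X]setTI; exact: mphi.
  by apply/seteqP; split=> v /=; rewrite in_itv.
rewrite (_ : phi @^-1` _ = [set v : 'rV[R]_n | enorm v ^+ n <= d] `\`
    [set v : 'rV[R]_n | enorm v ^+ n <= c]); last first.
  apply/seteqP; split=> v /=; rewrite in_itv/= ltNge.
    by move=> /andP[/negP ? ?].
  by move=> [-> /negP ->].
rewrite measureD//; last by rewrite [X in (X < _)%E](volume_phi_le d) ltry.
rewrite setIidr; last by move=> v /= vc; exact: le_trans cd.
by rewrite [X in (X - _)%E](volume_phi_le d) [X in (_ - X)%E](volume_phi_le c) mulrBl.
Qed.

(** The images of Lebesgue measure under [v |-> |v|^n] and a multiple of Lebesgue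
measure on the half-line agree on the intervals [(c, d]], which generate the Borel
sets: the ball [|v|^n <= t] has volume [t * ball_volume n]. *)
Lemma volume_enormXn (A : set (measurableTypeR R)) :
  measurable A -> A `<=` `[0, +oo[ ->
  lebesgue_rV R n [set v | A (enorm v ^+ n)] =
  ((ball_volume n)%:E * lebesgue_measure A)%E.
Proof.
move=> mA A0.
have V0 := ltW (@ball_volume_gt0 R n).
pose m2 := mscale (NngNum V0) (mrestr (@lebesgue_measure R)
  (measurable_itv `[0, +oo[ : measurable (_ : set (measurableTypeR R)))).
transitivity (m2 A); last first.
  by rewrite /m2/= /mscale/= /mrestr setIidl.
rewrite -[LHS]/(pushforward (lebesgue_rV R n) phi A).
pose G (k : nat) : set (measurableTypeR R) := `](- k%:R), k%:R]%classic.
apply: (@measure_unique _ R (measurableTypeR R) (@ocitv R) G) => //.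
- exact: ocitvI.
- by move=> k; exact: is_ocitv.
- apply/seteqP; split=> // x _; have [k kx] : exists k, `|x| < k%:R.
    by exists (Num.trunc `|x|).+1; exact: truncnS_gt.
  by exists k => //; rewrite /G /= in_itv/=; move: kx; rewrite ltr_norml => /andP[-> /ltW].
- move=> _ [[c d] _ <-]/=.
  have [cd|dc] := leP c d; last first.
    by rewrite set_itv_ge ?measure0// bnd_simp -leNgt ltW.
  rewrite volume_phi_itv// mulrC /m2/mscale/= /mrestr EFinM; congr (_ * _)%E.
  have [c0|c0] := leP 0 c.
    rewrite setIidl; last first.
      by move=> x /=; rewrite !in_itv/= => /andP[cx _]; rewrite andbT ltW// (le_lt_trans c0).
    rewrite max_l ?(le_trans c0)// lebesgue_measure_itv/= lte_fin.
    by case: ltP => // dc; rewrite (_ : d = c) ?subrr//; apply/eqP; rewrite eq_le dc.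
  rewrite (_ : _ `&` _ = `[0, d]%classic); last first.
    apply/seteqP; split=> x /=; rewrite !in_itv/= andbT; first by move=> [/andP[_ ->] ->].
    by move=> /andP[x0 ->]; rewrite (lt_le_trans c0).
  rewrite lebesgue_measure_itv/= lte_fin subr0.
  by case: ltP => // _; rewrite sube0.
- by move=> k; rewrite /G [X in (X < _)%E]volume_phi_itv ?ltry// (@le_trans _ _ 0)// oppr_le0.
Qed.

(** Integration in polar coordinates after the substitution [t = r^n], which
absorbs the Jacobian [n r^(n-1)]. *)
Lemma ge0_integral_enormXn (f : R -> \bar R) :
  measurable_fun setT f -> (forall t, 0 <= f t)%E ->
  (\int[lebesgue_rV R n]_v f (enorm v ^+ n)%R =
   (ball_volume n)%:E * \int[lebesgue_measure]_(t in `[0%R, +oo[) f t)%E.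
Proof.
move=> mf f0.
have V0 := ltW (@ball_volume_gt0 R n).
have m0 : measurable (`[0, +oo[%classic : set (measurableTypeR R)).
  exact: measurable_itv.
have mf0 : measurable_fun (`[0, +oo[%classic : set (measurableTypeR R)) f.
  exact: measurable_funS mf.
rewrite -(ge0_integral_mscale _ _ (NngNum V0))//.
rewrite -(eq_measure_integral (mscale (NngNum V0) lebesgue_measure)
  (m1 := pushforward (lebesgue_rV R n) phi)); last first.
  by move=> A mA A0; rewrite /mscale/=; exact: volume_enormXn.
rewrite ge0_integral_pushforward//.
rewrite (_ : phi @^-1` _ = setT)//.
by apply/seteqP; split=> v // _; rewrite /= in_itv/= phi_ge0.
Qed.

End radial.

(** * One-dimensional integrals of powers and logarithms *)

Section powR_ln_integrals.
Context {R : realType}.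

Lemma powR_cvg0 (b : R) : 0 < b -> t `^ (- b) @[t --> +oo] --> 0.
Proof.
move=> b0; apply/cvgr0Pnorm_lt => e e0; near=> t.
have t0 : 0 < t by near: t; exact: nbhs_pinfty_gt.
rewrite ger0_norm ?powR_ge0// powRN invf_plt ?posrE ?powR_gt0//.
rewrite (_ : e^-1 = (e^-1 `^ b^-1) `^ b); last first.
  by rewrite -powRrM mulVf ?gt_eqF// powRr1// invr_ge0 ltW.
apply: gt0_ltr_powR => //; rewrite ?nnegrE ?powR_ge0// ?ltW//.
Unshelve. all: by end_near. Qed.

(** This is [ln x <= x - 1] at [x = t^b]. *)
Lemma ln_le_powR (b t : R) : 0 < b -> 0 < t -> ln t <= t `^ b / b.
Proof.
move=> b0 t0; rewrite ler_pdivlMr// mulrC -ln_powR.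
have p0 : 0 < t `^ b by exact: powR_gt0.
have := @le_ln1Dx R (t `^ b - 1); rewrite [1 + _]addrC subrK.
by rewrite ltrBrDl subrr => /(_ p0)/le_trans; apply; rewrite lerBlDr lerDl.
Qed.

Variable al : R.
Hypothesis al0 : 0 < al.
Notation leb := (@lebesgue_measure R).

Let f (t : R) : R := t `^ (- 1 - al) * ln t.
(* an antiderivative of [f] that vanishes at infinity *)
Let F (t : R) : R := - (t `^ (- al) * (ln t / al + (al ^+ 2)^-1)).

Let powR_pred (t : R) : 0 < t -> t `^ (- 1 - al) = t `^ (- al) / t.
Proof.
move=> t0; rewrite addrC powRD; last by rewrite (gt_eqF t0) implybT.
by rewrite powR_inv1// ltW.
Qed.

Let is_derive_F (t : R) : 0 < t -> is_derive t 1 F (f t).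
Proof.
move=> t0.
have d1 := is_derive1_powR (- al) t0.
have d2 := is_derive1_ln t0.
apply: is_derive_eq.
rewrite /f /GRing.scale/= addr0 [- al - 1]addrC powR_pred//.
by field; rewrite !gt_eqF.
Qed.

Let derivable_f (t : R) : 0 < t -> derivable f t 1.
Proof.
move=> t0.
have d1 := is_derive1_powR (- 1 - al) t0.
have d2 := is_derive1_ln t0.
by apply: derivableM.
Qed.

Let continuous_F (t : R) : 0 < t -> {for t, continuous F}.
Proof.
move=> t0; apply: differentiable_continuous; apply/derivable1_diffP.
by have [] := is_derive_F t t0.
Qed.

Let F_cvg0 : F t @[t --> +oo] --> 0.
Proof.
rewrite -oppr0; apply: cvgN.
(* half of the decay of [t^(-al)] pays for the logarithm *)
pose b := al / 2; have b0 : 0 < b by rewrite divr_gt0.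
pose C := (b * al)^-1 + (al ^+ 2)^-1.
apply: (@squeeze_cvgr _ _ _ _ (cst 0) (fun t => C * t `^ (- b))); last 2 first.
- exact: cvg_cst.
- by rewrite -(mulr0 C); apply: cvgMr; exact: powR_cvg0.
near=> t.
have t1 : 1 <= t by near: t; exact: nbhs_pinfty_ge.
have t0 : 0 < t by rewrite (lt_le_trans _ t1).
have lt0 := ln_ge0 t1.
apply/andP; split.
  by rewrite mulr_ge0 ?powR_ge0// addr_ge0 ?divr_ge0 ?invr_ge0 ?sqr_ge0// ltW.
rewrite mulrDr mulrDl lerD//.
  have -> : t `^ (- al) = t `^ (- b) * t `^ (- b).
    rewrite -powRD; last by rewrite (gt_eqF t0) implybT.
    by congr powR; rewrite /b; field.
  rewrite (_ : _ * _ = t `^ (- b) * ln t * (t `^ (- b) / al)); last by ring.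
  rewrite (_ : _^-1 * _ = b^-1 * (t `^ (- b) / al)); last by rewrite invfM; ring.
  apply: ler_wpM2r; first by rewrite divr_ge0 ?powR_ge0// ltW.
  rewrite powRN ler_pdivrMl ?powR_gt0//.
  exact: ln_le_powR.
rewrite mulrC ler_wpM2l ?invr_ge0 ?sqr_ge0//.
by apply: ler_powR => //; rewrite lerN2 /b ler_pdivrMr// mulr_natr mulr2n lerDl ltW.
Unshelve. all: by end_near. Qed.

Lemma integral_powR_ln :
  (\int[leb]_(t in `[1%R, +oo[) (t `^ (- 1 - al) * ln t)%:E = ((al ^+ 2)^-1)%:E)%E.
Proof.
rewrite (@ge0_continuous_FTC2y _ f F 1 0).
- by rewrite sub0e /F -EFinN opprK ln1 mul0r add0r powR1 mul1r.
- by move=> t t1; rewrite mulr_ge0 ?powR_ge0// ln_ge0.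
- apply: derivable_within_continuous => t; rewrite in_itv/= andbT => t1.
  by apply: derivable_f; rewrite (lt_le_trans _ t1).
- exact: F_cvg0.
- by move=> t t1; have [] := is_derive_F t (lt_trans ltr01 t1).
- by apply: cvg_at_right_filter; exact: continuous_F.
- move=> t; rewrite in_itv/= andbT => t1.
  by rewrite derive1E; have [_ ->] := is_derive_F t (lt_trans ltr01 t1).
Qed.

Lemma integral_powR_lnV (a : R) : 0 < a < 1 ->
  (\int[leb]_(t in `[a, 1%R]) (t `^ (- 1 - al) * - ln t)%:E =
   ((al ^+ 2)^-1 - a `^ (- al) * (ln a / al + (al ^+ 2)^-1))%:E)%E.
Proof.
move=> /andP[a0 a1].
rewrite (@continuous_FTC2 _ (fun t => t `^ (- 1 - al) * - ln t) (\- F) a 1)//.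
- by rewrite -EFinB /F/= !opprK ln1 mul0r add0r powR1 mul1r.
- apply: derivable_within_continuous => t; rewrite in_itv/= => /andP[at1 _].
  rewrite (_ : (fun t => _) = (\- f)); last by apply/funext => x; rewrite /f/= mulrN.
  by apply: derivableN; exact: derivable_f (lt_le_trans a0 at1).
- split.
  + move=> t; rewrite in_itv/= => /andP[at1 _]; apply: derivableN.
    by have [] := is_derive_F t (lt_trans a0 at1).
  + by apply: cvg_at_right_filter; apply: cvgN; exact: continuous_F.
  + by apply: cvg_at_left_filter; apply: cvgN; exact: continuous_F.
- move=> t; rewrite in_itv/= => /andP[at1 _].
  have d := is_derive_F t (lt_trans a0 at1).
  by rewrite derive1E derive_val mulrN.
Qed.

Lemma integral_powR (a : R) : 0 < a ->
  (\int[leb]_(t in `[a, +oo[) (t `^ (- 1 - al))%:E = (a `^ (- al) / al)%:E)%E.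
Proof.
move=> a0.
pose H (t : R) := - (t `^ (- al) / al).
have dH (t : R) : 0 < t -> is_derive t 1 H (t `^ (- 1 - al)).
  move=> t0; have d1 := is_derive1_powR (- al) t0.
  apply: is_derive_eq.
  by rewrite /GRing.scale/= [- al - 1]addrC; field; rewrite gt_eqF.
rewrite (@ge0_continuous_FTC2y _ (fun t => t `^ (- 1 - al)) H a 0).
- by rewrite sub0e /H -EFinN opprK.
- by move=> t _; exact: powR_ge0.
- apply: derivable_within_continuous => t; rewrite in_itv/= andbT => at1.
  by have [] := is_derive1_powR (- 1 - al) (lt_le_trans a0 at1).
- rewrite -oppr0 -(mul0r al^-1); apply: cvgN; apply: cvgMl; exact: powR_cvg0.
- by move=> t at1; have [] := dH t (lt_trans a0 at1).
- apply: cvg_at_right_filter; apply: differentiable_continuous.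
  by apply/derivable1_diffP; have [] := dH a a0.
- move=> t; rewrite in_itv/= andbT => at1.
  by rewrite derive1E; have [_ ->] := dH t (lt_trans a0 at1).
Qed.

End powR_ln_integrals.

(** * Integrals of the three kernels *)

Section kernel_integrals.
Context {R : realType}.
Variables (n : nat) (s : R).
Hypotheses (n0 : (0 < n)%N) (s0 : 0 < s).
Notation leb := (@lebesgue_measure R).
Notation mu := (lebesgue_rV R n).

(** All the radial kernels below have the form [C h(|v|^n)], restricted to a set
[D] of values of [|v|^n]. *)
Lemma integral_radial (C : R) (h : R -> R) (D : set R) :
  0 <= C -> measurable D -> D `<=` `[0, +oo[ ->
  measurable_fun setT h -> (forall t, D t -> 0 <= h t) ->
  (\int[mu]_v (C * (h (enorm v ^+ n) * \1_D (enorm v ^+ n)))%:E =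
   (C * ball_volume n)%:E * \int[leb]_(t in D) (h t)%:E)%E.
Proof.
move=> C0 mD D0 mh h0.
have hD0 t : 0 <= h t * \1_D t.
  rewrite indicE; case: (boolP (t \in D)) => [/set_mem/h0 ?|_]; first by rewrite mulr1.
  by rewrite mulr0.
have mhD : measurable_fun setT (fun t => h t * \1_D t).
  by apply: measurable_funM => //; exact: measurable_indic.
rewrite (ge0_integral_enormXn n n0 (fun t => (C * (h t * \1_D t))%:E)); last 2 first.
- by apply/measurable_EFinP; exact: measurable_funM.
- by move=> t; rewrite lee_fin mulr_ge0.
under eq_integral do rewrite EFinM.
have m0 : measurable (`[0, +oo[%classic : set R) by exact: measurable_itv.
rewrite ge0_integralZl//; last 2 first.
- by apply: (@measurable_funS _ _ _ _ setT) => //; exact/measurable_EFinP.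
- by move=> t _; rewrite lee_fin.
rewrite muleA -EFinM [C * _]mulrC; congr (_ * _)%E.
rewrite integral_mkcond [RHS]integral_mkcond; apply: eq_integral => t _.
rewrite !patchE indicE; case: (boolP (t \in D)) => tD.
  by rewrite mulr1 mem_set//; apply: D0; exact/set_mem.
by rewrite mulr0; case: ifP.
Qed.

(* [|v|^(-n-2s) = t^(-1-al)] for [t = |v|^n] *)
Let al := 2 * s / n%:R.
Let nR : 0 < n%:R :> R. Proof. by rewrite ltr0n. Qed.
Let al0 : 0 < al. Proof. by rewrite divr_gt0// mulr_gt0. Qed.

Lemma kers_enormXn (v : 'rV[R]_n) : kers s v = (enorm v ^+ n) `^ (- 1 - al).
Proof.
rewrite /kers -powR_mulrn ?enorm_ge0// -powRrM; congr powR.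
by rewrite /al; field; rewrite gt_eqF.
Qed.

Lemma ln_enormXn (v : 'rV[R]_n) : ln (enorm v) = ln (enorm v ^+ n) / n%:R.
Proof.
by rewrite -powR_mulrn ?enorm_ge0// ln_powR mulrAC divff ?mul1r// gt_eqF.
Qed.

Let measurable_powR_pred : measurable_fun setT (fun t : R => t `^ (- 1 - al)).
Proof. exact: measurable_powR. Qed.

(** Only [t >= 1] contributes, and [n^-1 \int_1^oo t^(-1-al) ln t dt = n^-1 al^-2]
with [al = 2s/n]. *)
Lemma integral_kerm : 0 <= cns n s ->
  (\int[mu]_v (kerm s v)%:E = (cns n s * sphere_area R n / (4 * s ^+ 2))%:E)%E.
Proof.
move=> c0.
transitivity (\int[mu]_v (cns n s / n%:R * ((enorm v ^+ n) `^ (- 1 - al) *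
   ln (enorm v ^+ n) * \1_(`[1, +oo[) (enorm v ^+ n)))%:E)%E.
  apply: eq_integral => v _; congr EFin.
  rewrite /kerm kers_enormXn /neg_part opprK (ln_enormXn v) indicE; set T := _ ^+ n.
  have [T1|T1] := leP 1 T.
    rewrite mem_set/=; last by rewrite in_itv/= T1.
    rewrite max_r; first by ring.
    by rewrite divr_ge0 ?ln_ge0// ltW.
  rewrite memNset/=; last by rewrite in_itv/= andbT; apply/negP; rewrite -ltNge.
  by rewrite max_l ?mulr0// ler_pdivrMr// mul0r ln_le0// ltW.
rewrite (integral_radial _ (fun t => t `^ (- 1 - al) * ln t)); last 5 first.
- by rewrite divr_ge0// ltW.
- exact: measurable_itv.
- by move=> t /=; rewrite !in_itv/= !andbT => /(le_trans _); exact.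
- by apply: measurable_funM => //; exact: measurable_ln.
- by move=> t /=; rewrite in_itv/= andbT => t1; rewrite mulr_ge0 ?powR_ge0// ln_ge0.
rewrite integral_powR_ln// -EFinM sphere_areaE//; congr EFin.
by rewrite /al; field; rewrite !gt_eqF.
Qed.

(** Here [d^n < t <= 1] contributes.  The inequality [d < |v|] is strict so that the
remaining pairs [|x - y| <= d] include all those with [x], [y] in a set of
diameter [d]. *)
Lemma integral_kerp_far (d : R) : 0 <= cns n s -> 0 < d < 1 ->
  (\int[mu]_v (kerp s v * (d < enorm v)%R%:R)%:E =
   (cns n s * sphere_area R n *
     ((4 * s ^+ 2)^-1 - d `^ (- (2 * s)) * (ln d / (2 * s) + (4 * s ^+ 2)^-1)))%:E)%E.
Proof.
move=> c0 /andP[d0 d1].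
have dn0 : 0 < d ^+ n by rewrite exprn_gt0.
transitivity (\int[mu]_v (cns n s / n%:R * ((enorm v ^+ n) `^ (- 1 - al) *
   - ln (enorm v ^+ n) * \1_(`]d ^+ n, 1]) (enorm v ^+ n)))%:E)%E.
  apply: eq_integral => v _; congr EFin.
  rewrite /kerp kers_enormXn /pos_part (ln_enormXn v) indicE.
  rewrite -(@ltr_pXn2r _ n) ?nnegrE ?enorm_ge0 ?ltW//; set T := _ ^+ n.
  have [Td|Td] := ltP (d ^+ n) T; last first.
    by rewrite memNset/= ?mulr0// in_itv/= ltNge Td.
  have [T1|T1] := leP T 1.
    rewrite mem_set/=; last by rewrite in_itv/= Td.
    rewrite max_r; first by ring.
    by rewrite oppr_ge0 ler_pdivrMr// mul0r ln_le0.
  rewrite memNset/=; last by rewrite in_itv/= Td/=; apply/negP; rewrite -ltNge.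
  rewrite max_l ?mulr0 ?mul0r//.
  by rewrite oppr_le0 divr_ge0 ?ln_ge0// ltW.
have mh : measurable_fun setT (fun t : R => t `^ (- 1 - al) * - ln t).
  by apply: measurable_funM => //; apply: measurableT_comp => //; exact: measurable_ln.
rewrite (integral_radial _ (fun t => t `^ (- 1 - al) * - ln t)) //; last 3 first.
- by rewrite divr_ge0// ltW.
- move=> t /=; rewrite !in_itv/= !andbT => /andP[dt _].
  by rewrite ltW// (lt_trans _ dt).
- move=> t /=; rewrite in_itv/= => /andP[_ t1].
  by rewrite mulr_ge0 ?powR_ge0// oppr_ge0 ln_le0.
rewrite integral_itv_obnd_cbnd; last first.
  by apply: (@measurable_funS _ _ _ _ setT) => //; exact/measurable_EFinP.
rewrite integral_powR_lnV//; last by rewrite dn0 exprn_ilt1// ?gtn_eqF// ltW.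
rewrite -EFinM sphere_areaE//; congr EFin.
have -> : (d ^+ n) `^ (- al) = d `^ (- (2 * s)).
  by rewrite -powR_mulrn ?ltW// -powRrM; congr powR; rewrite /al; field; rewrite gt_eqF.
have -> : ln (d ^+ n) = n%:R * ln d by rewrite -powR_mulrn ?ltW// ln_powR.
by rewrite /al; field; rewrite !gt_eqF.
Qed.

Lemma integral_kers_far (d : R) : 0 < d ->
  (\int[mu]_v (kers s v * (d < enorm v)%R%:R)%:E < +oo)%E.
Proof.
move=> d0.
have dn0 : 0 < d ^+ n by rewrite exprn_gt0.
rewrite (_ : (fun v => _) = (fun v : 'rV[R]_n => (1 * ((enorm v ^+ n) `^ (- 1 - al) *
   \1_(`]d ^+ n, +oo[) (enorm v ^+ n)))%:E)); last first.
  apply/funext => v; congr EFin.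
  rewrite kers_enormXn indicE mul1r.
  rewrite -(@ltr_pXn2r _ n) ?nnegrE ?enorm_ge0 ?ltW//; set T := _ ^+ n.
  by congr (_ * (nat_of_bool _)%:R); apply/idP/idP => [?|/set_mem/=];
    [apply/mem_set|]; rewrite /= in_itv/= ?andbT.
rewrite (integral_radial _ (fun t => t `^ (- 1 - al)))//; last 2 first.
- by move=> t /=; rewrite !in_itv/= !andbT => dt; rewrite ltW// (lt_trans _ dt).
- by move=> t _; exact: powR_ge0.
rewrite integral_itv_obnd_cbnd; last first.
  by apply: (@measurable_funS _ _ _ _ setT) => //; exact/measurable_EFinP.
by rewrite integral_powR// -EFinM ltry.
Qed.

End kernel_integrals.

(** * Convergence of the Gamma integral *)

Section Gamma_function.
Context {R : realType}.
Notation leb := (@lebesgue_measure R).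

(** For [x < 1] the integrand blows up at [0]: integrate over [[1/(k+1), 1]] and
pass to the limit by monotone convergence. *)
Lemma integral_powR01_le (x : R) : 0 < x ->
  (\int[leb]_(t in `]0%R, 1%R]) (t `^ (x - 1))%:E <= (x^-1)%:E)%E.
Proof.
move=> x0.
pose D (k : nat) : set R := `[0 + k.+1%:R^-1, 1]%classic.
have kp (k : nat) : 0 < k.+1%:R^-1 :> R by rewrite invr_gt0.
have mf A : measurable_fun A (fun t : R => (t `^ (x - 1))%:E).
  by apply: (@measurable_funS _ _ _ _ setT) => //; apply/measurable_EFinP; exact: measurable_powR.
have ndD : {homo D : n m / (n <= m)%N >-> (n <= m)%O}.
  move=> k m km; apply/subsetPset => t; rewrite /D /= !in_itv/= !add0r => /andP[kt ->].
  by rewrite andbT (le_trans _ kt)// lef_pV2 ?posrE// ler_nat.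
have := @ge0_nondecreasing_set_cvg_integral _ (measurableTypeR R) R D (fun t => (t `^ (x - 1))%:E) leb ndD.
rewrite -(@itv_open_bnd_bigcup R false 1 0) => cv.
have {}cv := cv (fun k => measurable_itv _) (fun k => mf _)
  (fun k t _ => powR_ge0 t (x - 1)).
rewrite -(cvg_lim _ cv)//; apply: lime_le; first by apply/cvg_ex; eexists; exact: cv.
apply: nearW => k.
have [k0|k0] := posnP k.
  by rewrite /D k0 invr1 add0r set_itv1 integral_set1 lee_fin invr_ge0 ltW.
pose a : R := 0 + k.+1%:R^-1.
have a0 : 0 < a by rewrite /a add0r.
have a1 : a < 1 by rewrite /a add0r invf_lt1// ltr1n ltnS.
have dH (t : R) : 0 < t -> is_derive t 1 (fun t => t `^ x / x) (t `^ (x - 1)).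
  move=> t0; have d1 := is_derive1_powR x t0.
  apply: is_derive_eq.
  by rewrite /GRing.scale/=; field; rewrite gt_eqF.
have cH (t : R) : 0 < t -> {for t, continuous (fun t => t `^ x / x)}.
  move=> t0; apply: differentiable_continuous; apply/derivable1_diffP.
  by have [] := dH t t0.
rewrite (@continuous_FTC2 _ (fun t => t `^ (x - 1)) (fun t => t `^ x / x) a 1 a1).
- by rewrite -EFinB lee_fin powR1 mul1r lerBlDr lerDl divr_ge0 ?powR_ge0// ltW.
- apply: derivable_within_continuous => t; rewrite in_itv/= => /andP[at1 _].
  by have [] := is_derive1_powR (x - 1) (lt_le_trans a0 at1).
- split.
  + move=> t; rewrite in_itv/= => /andP[at1 _].
    by have [] := dH t (lt_trans a0 at1).
  + by apply: cvg_at_right_filter; exact: cH.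
  + by apply: cvg_at_left_filter; exact: cH.
- move=> t; rewrite in_itv/= => /andP[at1 _].
  by rewrite derive1E; have [_ ->] := dH t (lt_trans a0 at1).
Qed.

(** After taking logarithms this is [ln (t/y) <= t/y - 1]. *)
Lemma expRN_le_powR (y t : R) : 0 < y -> 0 < t -> expR (- t) <= y `^ y * t `^ (- y).
Proof.
move=> y0 t0; rewrite expRN powRN.
rewrite ler_pdivlMr ?powR_gt0// mulrC ler_pdivrMr ?expR_gt0//.
rewrite /powR !gt_eqF// -expRD ler_expR.
have := @le_ln1Dx R (t / y - 1); rewrite [1 + _]addrC subrK ltrBrDl subrr.
rewrite divr_gt0// ln_div ?posrE// => /(_ isT) h.
have : y * (ln t - ln y) <= y * (t / y - 1) by rewrite ler_wpM2l// ltW.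
rewrite mulrBr [y * (_ - 1)]mulrBr mulr1 mulrCA divff ?gt_eqF// mulr1.
lra.
Qed.

(** The value is the [fine] part of an extended real, hence [0] if the integral
diverges: positivity needs convergence.  Near [0] the integrand is at most
[t^(x-1)], and for [t >= 1] it is at most a multiple of [t^(-2)]. *)
Lemma Gamma_gt0 (x : R) : 0 < x -> 0 < Gamma x.
Proof.
move=> x0; rewrite /Gamma /Rintegral.
pose g (t : R) : R := t `^ (x - 1) * expR (- t).
have mg A : measurable_fun A (EFin \o g).
  apply: (@measurable_funS _ _ _ _ setT) => //; apply/measurable_EFinP.
  apply: measurable_funM; first exact: measurable_powR.
  exact: measurableT_comp.
have g0 (t : R) : 0 < t -> 0 < g t.
  by move=> t0; rewrite mulr_gt0 ?powR_gt0 ?expR_gt0.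
have gge0 (t : R) : 0 <= g t by rewrite mulr_ge0 ?powR_ge0 ?expR_ge0.
apply: fine_gt0; apply/andP; split.
  rewrite lt0e integral_ge0; last by move=> t _; rewrite lee_fin gge0.
  rewrite andbT; apply/eqP => I0.
  have [+ _] := ae_eq_integral_abs leb (measurable_itv `]0%R, +oo[) (mg _).
  have -> : (\int[leb]_(t in `]0%R, +oo[) `|(EFin \o g) t| = 0)%E.
    by rewrite -[RHS]I0; apply: eq_integral => t _; rewrite gee0_abs// lee_fin gge0.
  move=> /(_ erefl) [N [mN N0 sN]].
  suff : (leb `]0%R, 1%R] <= leb N)%E.
    by rewrite N0 lebesgue_measure_itv/= lte01 sube0 leNgt lte01.
  apply: le_measure; rewrite ?inE//
  => t /=; rewrite in_itv/= => /andP[t0 _]; apply: sN => /= h.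
  have : (EFin \o g) t = 0%E by apply: h; rewrite /= in_itv/= t0.
  by move=> /= -[] g00; have := g0 t t0; rewrite g00 ltxx.
rewrite (@itv_bndbnd_setU _ _ _ (BRight 1))//; last by rewrite bnd_simp.
rewrite ge0_integral_setU//=; last 3 first.
- exact: mg.
- by move=> t _; rewrite lee_fin gge0.
- apply/disj_setPS => t /= []; rewrite !in_itv/= andbT => /andP[_ t1].
  by rewrite ltNge t1.
apply: lte_add_pinfty.
  apply: (@le_lt_trans _ _ (x^-1)%:E); last exact: ltry.
  apply: le_trans (integral_powR01_le x x0).
  apply: ge0_le_integral => //=.
  - by move=> t _; rewrite lee_fin gge0.
  - exact: mg.
  - apply: (@measurable_funS _ _ _ _ setT) => //; apply/measurable_EFinP; exact: measurable_powR.
  - move=> t; rewrite in_itv/= => /andP[t0 _]; rewrite lee_fin /g ler_piMr ?powR_ge0//.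
    by rewrite -expR0 ler_expR oppr_le0 ltW.
(* with this exponent, [t^(x-1) e^(-t) <= y^y t^(x-1-y) = y^y t^(-2)] *)
pose y := x + 1; have y0 : 0 < y by rewrite addr_gt0.
rewrite integral_itv_obnd_cbnd; last exact: mg.
apply: (@le_lt_trans _ _ (\int[leb]_(t in `[1%R, +oo[) ((y `^ y)%:E * (t `^ (- 1 - 1))%:E))%E).
  have mp : measurable_fun (`[1%R, +oo[%classic : set R) (fun t : R => (t `^ (- 1 - 1))%:E).
    by apply: (@measurable_funS _ _ _ _ setT) => //; apply/measurable_EFinP; exact: measurable_powR.
  apply: ge0_le_integral => //=.
  - by move=> t _; rewrite lee_fin gge0.
  - exact: mg.
  - exact: emeasurable_funM.
  - move=> t; rewrite in_itv/= andbT => t1; have t0 := lt_le_trans ltr01 t1.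
    rewrite lee_fin /g mulrC (_ : - 1 - 1 = - y + (x - 1)); last by rewrite /y; ring.
    rewrite [t `^ (- y + _)]powRD; last by rewrite (gt_eqF t0) implybT.
    by rewrite mulrA ler_wpM2r ?powR_ge0// expRN_le_powR.
rewrite ge0_integralZl//; last 3 first.
- by apply: (@measurable_funS _ _ _ _ setT) => //; apply/measurable_EFinP; exact: measurable_powR.
- by move=> t _; rewrite lee_fin powR_ge0.
- by rewrite lee_fin powR_ge0.
by rewrite integral_powR// -EFinM ltry.
Qed.

Lemma cns_gt0 n (s : R) : 0 < s -> s < 1 -> 0 < cns n s.
Proof.
move=> s0 s1; rewrite /cns mulr_gt0 ?divr_gt0 ?mulr_gt0 ?powR_gt0 ?pi_gt0 ?Gamma_gt0//.
- by rewrite divr_gt0// ltr_wpDl// mulr_gt0.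
- by rewrite subr_gt0.
Qed.

End Gamma_function.

(** * Quadratic forms of difference kernels *)

Section kernel_forms.
Context {R : realType}.
Variable n : nat.
Notation mu := (lebesgue_rV R n).
Notation V := ('rV[R]_n).
Implicit Types (u w : V -> R) (k : V -> R).

Lemma measurable_on_fst (f : V -> R) :
  measurable_fun setT f -> measurable_fun setT (fun p : V * V => f p.1).
Proof. by move=> mf; exact: (measurableT_comp mf measurable_fst). Qed.

Lemma measurable_on_snd (f : V -> R) :
  measurable_fun setT f -> measurable_fun setT (fun p : V * V => f p.2).
Proof. by move=> mf; exact: (measurableT_comp mf measurable_snd). Qed.

Lemma measurable_rV_sub : measurable_fun setT (fun p : V * V => p.1 - p.2).
Proof.
apply: measurable_fun_rVP => i; under eq_fun do rewrite !mxE.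
apply: measurable_funB.
  exact: (measurable_on_fst (fun v => v ord0 i) (measurable_coord_rV i)).
exact: (measurable_on_snd (fun v => v ord0 i) (measurable_coord_rV i)).
Qed.

Lemma integral_reflect_translate k (x : V) :
  measurable_fun setT k -> (forall z, 0 <= k z) ->
  (\int[mu]_y (k (x - y))%:E = \int[mu]_z (k z)%:E)%E.
Proof.
move=> mk k0.
have := @ge0_integral_rV_affine R n (-1) x (EFin \o k).
rewrite normrN1 expr1n invr1 mul1e oppr_eq0 oner_eq0 => <-//.
- by apply: eq_integral => y _ /=; rewrite scaleN1r addrC.
- exact/measurable_EFinP.
Qed.

Lemma integral_translate k (y : V) :
  measurable_fun setT k -> (forall z, 0 <= k z) ->
  (\int[mu]_x (k (x - y))%:E = \int[mu]_z (k z)%:E)%E.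
Proof.
move=> mk k0.
have := @ge0_integral_rV_affine R n 1 (- y) (EFin \o k).
rewrite normr1 expr1n invr1 mul1e oner_eq0 => <-//.
- by apply: eq_integral => x _ /=; rewrite scale1r.
- exact/measurable_EFinP.
Qed.

Variable k : V -> R.
Hypotheses (mk : measurable_fun setT k) (k0 : forall z, 0 <= k z).

Let mk2 : measurable_fun setT (fun p : V * V => k (p.1 - p.2)).
Proof. exact: (measurableT_comp mk measurable_rV_sub). Qed.

Lemma integral_fst_mul_kernel (g : V -> R) :
  measurable_fun setT g -> (forall x, 0 <= g x) ->
  (\int[mu \x mu]_p (g p.1 * k (p.1 - p.2))%:E =
   \int[mu]_x (g x)%:E * \int[mu]_z (k z)%:E)%E.
Proof.
move=> mg g0.
have K0 : (0 <= \int[mu]_z (k z)%:E)%E by apply: integral_ge0 => z _; rewrite lee_fin.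
rewrite fubini_tonelli1/=; last 2 first.
- apply/measurable_EFinP; apply: measurable_funM => //.
  exact: measurable_on_fst.
- by move=> p; rewrite lee_fin mulr_ge0.
transitivity (\int[mu]_x ((g x)%:E * \int[mu]_z (k z)%:E))%E; last first.
  rewrite ge0_integralZr//; first exact/measurable_EFinP.
  by move=> x _; rewrite lee_fin.
apply: eq_integral => x _; rewrite /fubini_F/=.
under eq_integral do rewrite EFinM.
rewrite ge0_integralZl//; last 3 first.
- apply/measurable_EFinP; apply: (measurableT_comp mk).
  apply: measurable_fun_rVP => i; under eq_fun do rewrite !mxE.
  by apply: measurable_funB => //; exact: measurable_coord_rV.
- by move=> y _; rewrite lee_fin.
- by rewrite lee_fin.
by rewrite integral_reflect_translate.
Qed.

Lemma integral_snd_mul_kernel (g : V -> R) :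
  measurable_fun setT g -> (forall x, 0 <= g x) ->
  (\int[mu \x mu]_p (g p.2 * k (p.1 - p.2))%:E =
   \int[mu]_x (g x)%:E * \int[mu]_z (k z)%:E)%E.
Proof.
move=> mg g0.
have K0 : (0 <= \int[mu]_z (k z)%:E)%E by apply: integral_ge0 => z _; rewrite lee_fin.
rewrite fubini_tonelli2/=; last 2 first.
- apply/measurable_EFinP; apply: measurable_funM => //.
  exact: measurable_on_snd.
- by move=> p; rewrite lee_fin mulr_ge0.
transitivity (\int[mu]_x ((g x)%:E * \int[mu]_z (k z)%:E))%E; last first.
  rewrite ge0_integralZr//; first exact/measurable_EFinP.
  by move=> x _; rewrite lee_fin.
apply: eq_integral => y _; rewrite /fubini_G/=.
under eq_integral do rewrite EFinM.
rewrite ge0_integralZl//; last 3 first.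
- apply/measurable_EFinP; apply: (measurableT_comp mk).
  apply: measurable_fun_rVP => i; under eq_fun do rewrite !mxE.
  by apply: measurable_funB => //; exact: measurable_coord_rV.
- by move=> x _; rewrite lee_fin.
- by rewrite lee_fin.
by rewrite integral_translate.
Qed.

Lemma measurable_kernel_integrand u w :
  measurable_fun setT u -> measurable_fun setT w ->
  measurable_fun setT (fun p : V * V =>
    (((u p.1 - u p.2) * (w p.1 - w p.2)) * k (p.1 - p.2))%:E).
Proof.
move=> mu_ mw; apply/measurable_EFinP; apply: measurable_funM => //.
apply: measurable_funM; apply: measurable_funB.
- exact: measurable_on_fst.
- exact: measurable_on_snd.
- exact: measurable_on_fst.
- exact: measurable_on_snd.
Qed.

Let integrand_ge0 u p : (0 <= ((u p.1 - u p.2) * (u p.1 - u p.2) * k (p.1 - p.2))%:E)%E.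
Proof. by rewrite lee_fin mulr_ge0// -expr2 sqr_ge0. Qed.

Lemma kernel_form_ge0 u : (0 <= kernel_form k u u)%E.
Proof. by apply: integral_ge0 => p _; exact: integrand_ge0. Qed.

Lemma ae_fst (P : V -> Prop) :
  {ae mu, forall x, P x} -> {ae (mu \x mu)%E, forall p : V * V, P p.1}.
Proof.
move=> [N [mN N0 sN]]; exists (N `*` setT); split.
- exact: measurableX.
- by rewrite product_measure1E// [X in (X * _)%E]N0 mul0e.
- by move=> p /= Pp; split => //; apply: sN.
Qed.

Lemma ae_snd (P : V -> Prop) :
  {ae mu, forall x, P x} -> {ae (mu \x mu)%E, forall p : V * V, P p.2}.
Proof.
move=> [N [mN N0 sN]]; exists (setT `*` N); split.
- exact: measurableX.
- by rewrite product_measure1E// [X in (_ * X)%E]N0 mule0.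
- by move=> p /= Pp; split => //; apply: sN.
Qed.

Lemma kernel_form_ae_eq u w : measurable_fun setT u -> measurable_fun setT w ->
  {ae mu, forall x, u x = w x} -> kernel_form k u u = kernel_form k w w.
Proof.
move=> mu_ mw uw; apply: ge0_ae_eq_integral => //.
- exact: measurable_kernel_integrand.
- exact: measurable_kernel_integrand.
- apply: filterS2 (ae_fst _ uw) (ae_snd _ uw) => p /= -> ->.
  by [].
Qed.

Lemma kernel_form_opp u : kernel_form k (\- u) (\- u) = kernel_form k u u.
Proof. by apply: eq_integral => p _ /=; congr EFin; ring. Qed.

Lemma kernel_form_le u w : measurable_fun setT u -> measurable_fun setT w ->
  (forall x y, (u x - u y) ^+ 2 <= (w x - w y) ^+ 2) ->
  (kernel_form k u u <= kernel_form k w w)%E.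
Proof.
move=> mu_ mw uw; apply: ge0_le_integral => //.
- exact: measurable_kernel_integrand.
- exact: measurable_kernel_integrand.
- by move=> p _; rewrite lee_fin ler_wpM2r// -!expr2.
Qed.

(** Integrate in one variable at a time: translation invariance makes each of the
two inner integrals equal to [\int k]. *)
Lemma integral_sqr_sum_kernel u : measurable_fun setT u ->
  (\int[mu \x mu]_p ((u p.1 ^+ 2 + u p.2 ^+ 2) * k (p.1 - p.2))%:E =
   2%:E * (\int[mu]_x (u x ^+ 2)%:E * \int[mu]_z (k z)%:E))%E.
Proof.
move=> mu_.
have mu2 : measurable_fun setT (fun x => u x ^+ 2) by exact: measurable_funX.
have u0 x : 0 <= u x ^+ 2 by exact: sqr_ge0.
under eq_integral do rewrite mulrDl EFinD.
rewrite ge0_integralD//; last 4 first.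
- by move=> p _; rewrite lee_fin mulr_ge0.
- apply/measurable_EFinP; apply: measurable_funM => //.
  exact: (measurable_on_fst (fun x => u x ^+ 2)).
- by move=> p _; rewrite lee_fin mulr_ge0.
- apply/measurable_EFinP; apply: measurable_funM => //.
  exact: (measurable_on_snd (fun x => u x ^+ 2)).
rewrite (integral_fst_mul_kernel (fun x => u x ^+ 2))//.
by rewrite (integral_snd_mul_kernel (fun x => u x ^+ 2))// mule_natl mule2n.
Qed.

(** From [(a - b)^2 <= 2 (a^2 + b^2)]. *)
Lemma kernel_form_le_L2 u : measurable_fun setT u ->
  (kernel_form k u u <=
   4%:E * (\int[mu]_x (u x ^+ 2)%:E * \int[mu]_z (k z)%:E))%E.
Proof.
move=> mu_.
rewrite (_ : 4%:E = 2%:E * 2%:E)%E; last by rewrite -EFinM; congr EFin; ring.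
rewrite -muleA -integral_sqr_sum_kernel//.
have mS : measurable_fun setT
    (fun p : V * V => ((u p.1 ^+ 2 + u p.2 ^+ 2) * k (p.1 - p.2))%:E).
  apply/measurable_EFinP; apply: measurable_funM => //; apply: measurable_funD.
  - by apply: measurable_funX; exact: measurable_on_fst.
  - by apply: measurable_funX; exact: measurable_on_snd.
have S0 p : (0 <= ((u p.1 ^+ 2 + u p.2 ^+ 2) * k (p.1 - p.2))%:E)%E.
  by rewrite lee_fin mulr_ge0// addr_ge0 ?sqr_ge0.
rewrite -ge0_integralZl//.
apply: ge0_le_integral => //.
- exact: measurable_kernel_integrand.
- exact: emeasurable_funM.
- move=> p _; rewrite -EFinM lee_fin mulrA ler_wpM2r//.
  by have := sqr_ge0 (u p.1 + u p.2); lra.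
Qed.

(** The cross term [2 u(x) u(y)] disappears wherever the kernel does not. *)
Lemma kernel_form_eq_L2 u : measurable_fun setT u ->
  (forall x y, k (x - y) != 0 -> u x * u y = 0) ->
  kernel_form k u u =
   (2%:E * (\int[mu]_x (u x ^+ 2)%:E * \int[mu]_z (k z)%:E))%E.
Proof.
move=> mu_ uk; rewrite -integral_sqr_sum_kernel//.
apply: eq_integral => p _; congr EFin.
have [->|/uk uu] := eqVneq (k (p.1 - p.2)) 0; first by rewrite !mulr0.
by congr (_ * _); rewrite -expr2 sqrrB uu mul0rn subr0.
Qed.

End kernel_forms.

(** * Bounded open sets and square-integrable functions *)

Section domains.
Context {R : realType} {n : nat}.
Notation V := ('rV[R]_n).
Implicit Types (Omega : set V).

Lemma open_rV_box Omega (x : V) : open Omega -> Omega x ->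
  exists2 e : R, 0 < e &
    forall y : V, (forall i, `|x ord0 i - y ord0 i| < e) -> Omega y.
Proof.
move=> oO Ox; have /nbhs_ballP[e /= e0 eO] := open_nbhs_nbhs (conj oO Ox).
exists e => // y xy; apply: eO; split=> // i j; rewrite ord1; exact: xy.
Qed.

(** The sigma-algebra is generated by the coordinates, so an open set has to be
written as a countable union of boxes; those with rational centre and half-side
[1/(k+1)] suffice. *)
Lemma open_measurable_rV Omega : open Omega -> measurable Omega.
Proof.
move=> oO.
pose box (q : 'rV[rat]_n * nat) : set V :=
  [set v | forall i, `|ratr (q.1 ord0 i) - v ord0 i| < q.2.+1%:R^-1].
have mbox q : measurable (box q).
  rewrite (_ : box q = \bigcap_(i in [set: 'I_n])
      ((fun v => v ord0 i) @^-1` `]ratr (q.1 ord0 i) - q.2.+1%:R^-1,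
         ratr (q.1 ord0 i) + q.2.+1%:R^-1[)).
    apply: fin_bigcap_measurable => // i _.
    by rewrite -[X in measurable X]setTI; exact: measurable_coord_rV.
  by apply/seteqP; split=> v /= vr i; [move=> _|]; have := vr i;
    rewrite /= ?in_itv/= distrC ltr_distl => //; apply.
rewrite (_ : Omega = \bigcup_q (if `[< box q `<=` Omega >] then box q else set0)).
  apply: countable_bigcupT_measurable => // q.
  by case: ifP.
apply/seteqP; split=> [x Ox|x [q _]]; last by case: asboolP => // h; exact: h.
have [e e0 eO] := open_rV_box Omega x oO Ox.
(* any point of the box is within [2/(k+1) < e] of [x] *)
pose k := Num.trunc (2 / e).
have ke : 2 * k.+1%:R^-1 < e.
  by rewrite ltr_pdivrMr// mulrC -ltr_pdivrMr//; exact: truncnS_gt.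
have k0 : 0 < k.+1%:R^-1 :> R by rewrite invr_gt0.
have qx (i : 'I_n) : exists q : rat, `|ratr q - x ord0 i| < k.+1%:R^-1.
  have [] := @dense_rat R (ball (x ord0 i) k.+1%:R^-1).
  - by exists (x ord0 i); exact: ballxx.
  - exact: ball_open.
  - by move=> z [/= + [q _ qz]]; rewrite -qz /ball/= distrC => ?; exists q.
have [q hq] := choice qx.
have bx : box (\row_i q i, k) x by move=> i /=; rewrite mxE.
exists (\row_i q i, k) => //; case: asboolP => // -[] y hy; apply: eO => i.
apply: lt_trans ke; have := ltrD (bx i) (hy i) => /=.
rewrite (_ : 2 / _ = k.+1%:R^-1 + k.+1%:R^-1); last by rewrite mulr_natl mulr2n.
by apply: le_lt_trans; rewrite [X in _ <= X + _]distrC; exact: ler_distD.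
Qed.

(** A supremum of reals is only meaningful for a bounded set, and boundedness is
given for the sup norm; hence the detour through coordinates. *)
Lemma diam_ub Omega : bounded_set Omega ->
  forall x y, Omega x -> Omega y -> enorm (x - y) <= diam Omega.
Proof.
move=> [M [_ bM]] x y Ox Oy.
pose B : R := `|M| + 1.
have nB (v : V) i : Omega v -> `|v ord0 i| <= B.
  move=> Ov; have vB : `|v| <= B.
    by apply: bM => //; rewrite /B (le_lt_trans (ler_norm M))// ltrDl.
  apply: le_trans vB; rewrite /Num.norm/= mx_normrE.
  exact: (le_bigmax _ (fun ij : 'I_1 * 'I_n => `|v ij.1 ij.2|) (ord0, i)).
apply: sup_ubound; last by exists (x, y).
exists (n%:R * (B + B)) => _ [[a b] [/= Oa Ob] <-].
apply: enorm_le_cube => i; rewrite !mxE.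
by rewrite (le_trans (ler_normB _ _))// lerD// nB.
Qed.

Lemma diam_gt0 Omega : (0 < n)%N -> bounded_set Omega -> open Omega ->
  Omega !=set0 -> 0 < diam Omega.
Proof.
move=> n0 bO oO [x Ox].
have [e e0 eO] := open_rV_box Omega x oO Ox.
pose i0 := Ordinal n0.
pose y : V := \row_i (x ord0 i + (e / 2) *+ (i == i0)).
have e2 : 0 < e / 2 by rewrite divr_gt0.
have Oy : Omega y.
  apply: eO => i; rewrite mxE opprD addrA subrr add0r normrN.
  case: (i == i0); last by rewrite mulr0n normr0.
  by rewrite mulr1n gtr0_norm// ltr_pdivrMr// ltr_pMr// ltr1n.
apply: lt_le_trans (diam_ub Omega bO y x Oy Ox).
apply: lt_le_trans (coord_le_enorm _ i0).
by rewrite !mxE eqxx mulr1n addrC addKr gtr0_norm.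
Qed.

Lemma Lfun2_measurable (u : V -> R) :
  u \in Lfun (lebesgue_rV R n) 2%:E -> measurable_fun setT u.
Proof. by rewrite inE => /andP[]; rewrite inE. Qed.

Lemma Lnorm2_sqr (u : V -> R) :
  ('N[lebesgue_rV R n]_2%:E[EFin \o u] ^+ 2 =
   \int[lebesgue_rV R n]_x (u x ^+ 2)%:E)%E.
Proof.
have := @poweR_Lnorm _ _ _ (lebesgue_rV R n) (EFin \o u) 2.
rewrite pnatr_eq0 => /(_ isT).
under eq_integral do rewrite /= powR_mulrn// real_normK ?num_real//.
move=> <-; have := Lnorm_ge0 (lebesgue_rV R n) 2%:E (EFin \o u).
case: Lnorm => [r|_|//].
- by rewrite lee_fin => r0; rewrite poweR_EFin powR_mulrn.
- by rewrite poweRyr// expe2 mulyy.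
Qed.

Lemma Lfun2_sqr_lty (u : V -> R) : u \in Lfun (lebesgue_rV R n) 2%:E ->
  (\int[lebesgue_rV R n]_x (u x ^+ 2)%:E < +oo)%E.
Proof.
rewrite inE => /andP[_]; rewrite inE/= /finite_norm -Lnorm2_sqr.
have := Lnorm_ge0 (lebesgue_rV R n) 2%:E (EFin \o u).
by case: Lnorm => // r _ _; rewrite -EFin_expe ltry.
Qed.

Lemma L2norm_sqr Omega (u : V -> R) :
  (L2norm Omega u ^+ 2 = \int[lebesgue_rV R n]_x ((u \_ Omega) x ^+ 2)%:E)%E.
Proof. by rewrite /L2norm restrict_EFin Lnorm2_sqr. Qed.

End domains.

(** * Comparison of forms, and the form of the absolute value *)

Section kernel_comparison.
Context {R : realType} {n : nat}.
Notation mu := (lebesgue_rV R n).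
Notation V := ('rV[R]_n).
Implicit Types (u w k : V -> R).

Lemma kernel_form_le_kernel k1 k2 u :
  measurable_fun setT k1 -> (forall z, 0 <= k1 z) ->
  measurable_fun setT k2 -> (forall z, k1 z <= k2 z) ->
  measurable_fun setT u ->
  (kernel_form k1 u u <= kernel_form k2 u u)%E.
Proof.
move=> mk1 k10 mk2 k12 mu_; apply: ge0_le_integral => //.
- by move=> p _; rewrite lee_fin mulr_ge0// -expr2 sqr_ge0.
- exact: measurable_kernel_integrand.
- exact: measurable_kernel_integrand.
- by move=> p _; rewrite lee_fin ler_wpM2l// -expr2 sqr_ge0.
Qed.

Lemma kernel_form_kernelDZ (a : R) k1 k2 u : 0 <= a ->
  measurable_fun setT k1 -> (forall z, 0 <= k1 z) ->
  measurable_fun setT k2 -> (forall z, 0 <= k2 z) ->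
  measurable_fun setT u ->
  kernel_form (fun z => a * k1 z + k2 z) u u =
  (a%:E * kernel_form k1 u u + kernel_form k2 u u)%E.
Proof.
move=> a0 mk1 k10 mk2 k20 mu_.
have g0 k : (forall z, 0 <= k z) -> forall p : V * V,
    (0 <= ((u p.1 - u p.2) * (u p.1 - u p.2) * k (p.1 - p.2))%:E)%E.
  by move=> k0 p; rewrite lee_fin mulr_ge0// -expr2 sqr_ge0.
rewrite /kernel_form -ge0_integralZl//; last 2 first.
- exact: measurable_kernel_integrand.
- by move=> p _; exact: g0.
rewrite -ge0_integralD//; last 4 first.
- by move=> p _; rewrite mule_ge0// g0.
- by apply: emeasurable_funM => //; exact: measurable_kernel_integrand.
- by move=> p _; exact: g0.
- exact: measurable_kernel_integrand.
by apply: eq_integral => p _; rewrite -EFinM -EFinD; congr EFin; ring.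
Qed.

(** This is [||a| - |b|| <= |a - b|] inside the integral. *)
Lemma kernel_form_abs_le k u : measurable_fun setT k -> (forall z, 0 <= k z) ->
  measurable_fun setT u ->
  (kernel_form k (fun x => `|u x|%R) (fun x => `|u x|%R) <= kernel_form k u u)%E.
Proof.
move=> mk k0 mu_; apply: kernel_form_le => //; first exact: measurableT_comp.
move=> x y; rewrite !sqrrB !real_normK ?num_real// lerD2r lerD2l lerN2.
by rewrite ler_pMn2r// -normrM ler_norm.
Qed.

(** The difference of the two forms is the integral of the nonnegative function
[D(x,y) = 2 (|u(x) u(y)| - u(x) u(y)) k(x-y)].  It vanishes, so [D = 0] almost
everywhere; as [D > 0] on [{u > 0} x {u < 0}], this product is null, and so is
one of its factors. *)
Lemma kernel_form_abs_eq_sign k u :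
  measurable_fun setT k -> (forall z, 0 <= k z) -> measurable_fun setT u ->
  (kernel_form k u u < +oo)%E ->
  (forall x y, 0 < u x -> u y < 0 -> 0 < k (x - y)) ->
  kernel_form k (fun x => `|u x|) (fun x => `|u x|) = kernel_form k u u ->
  keeps_sign u.
Proof.
move=> mk k0 mu_ fin kpos eqE.
have ma : measurable_fun setT (fun x => `|u x|) by exact: measurableT_comp.
have mkS := measurable_kernel_integrand n k mk.
pose D (p : V * V) : \bar R :=
  (2 * (`|u p.1| * `|u p.2| - u p.1 * u p.2) * k (p.1 - p.2))%:E.
have D0 p : (0 <= D p)%E.
  by rewrite lee_fin mulr_ge0// mulr_ge0// -normrM subr_ge0 ler_norm.
have mD : measurable_fun setT D.
  apply/measurable_EFinP; apply: measurable_funM.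
    apply: measurable_funM => //; apply: measurable_funB; apply: measurable_funM.
    - exact: (measurable_on_fst n (fun x => `|u x|)).
    - exact: (measurable_on_snd n (fun x => `|u x|)).
    - exact: measurable_on_fst.
    - exact: measurable_on_snd.
  exact: (measurableT_comp mk (measurable_rV_sub n)).
have E : (kernel_form k u u = kernel_form k u u + \int[mu \x mu]_p D p)%E.
  rewrite -{2}eqE /kernel_form -ge0_integralD//; last 2 first.
  - by move=> p _; rewrite lee_fin mulr_ge0// -expr2 sqr_ge0.
  - exact: (mkS (fun x => `|u x|) (fun x => `|u x|)).
  apply: eq_integral => p _; rewrite -EFinD; congr EFin.
  have h (a : R) : `|a| * `|a| = a * a by rewrite -!expr2 real_normK ?num_real.
  have := h (u p.1); have := h (u p.2).
  move: `|u p.1| `|u p.2| => a b hb ha.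
  rewrite -mulrDl; congr (_ * _).
  rewrite !mulrBl !mulrBr ha hb; ring.
have I0 : (\int[mu \x mu]_p `|D p| = 0)%E.
  under eq_integral do rewrite gee0_abs//.
  have f1 : kernel_form k u u \is a fin_num by rewrite ge0_fin_numE// kernel_form_ge0.
  move: E; rewrite -(fineK f1); set I := integral _ _ _.
  by case: I => [b [] h| |] //; congr EFin; lra.
have [+ _] := ae_eq_integral_abs (mu \x mu)%E measurableT mD.
move=> /(_ I0) [N [mN N0 sN]].
pose A := [set x | 0 < u x]; pose B := [set x | u x < 0].
have mA : measurable A.
  rewrite (_ : A = u @^-1` `]0, +oo[).
    by rewrite -[X in measurable X]setTI; exact: mu_.
  by apply/seteqP; split=> x /=; rewrite in_itv/= andbT.
have mB : measurable B.
  rewrite (_ : B = u @^-1` `]-oo, 0[).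
    by rewrite -[X in measurable X]setTI; exact: mu_.
  by apply/seteqP; split=> x /=; rewrite in_itv.
have : ((mu \x mu)%E (A `*` B) <= (mu \x mu)%E N)%E.
  apply: le_measure; rewrite ?inE//; first exact: measurableX.
  move=> [x y] [/= Ax By]; apply: sN => /= h.
  have [] := h I; apply/eqP; rewrite gt_eqF// mulr_gt0//; last exact: kpos.
  rewrite mulr_gt0// subr_gt0 (@lt_le_trans _ _ 0) ?mulr_ge0//.
  by rewrite pmulr_rlt0.
rewrite N0 product_measure1E// => AB0.
have : (mu A * mu B == 0)%E by rewrite eq_le AB0 mule_ge0.
rewrite mule_eq0 =>  /orP[/eqP A0|/eqP B0]; [right|left].
- exists A; split => // x /= /negP; rewrite -ltNge//.
- exists B; split => // x /= /negP; rewrite -ltNge//.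
Qed.

Lemma integral_sqr_eq0 u : measurable_fun setT u ->
  (\int[mu]_x (u x ^+ 2)%:E = 0)%E -> {ae mu, forall x, u x = 0}.
Proof.
move=> mu_ I0.
have m2 : measurable_fun setT (fun x => (u x ^+ 2)%:E).
  by apply/measurable_EFinP; exact: measurable_funX.
have [+ _] := ae_eq_integral_abs mu measurableT m2.
have -> : (\int[mu]_x `|(u x ^+ 2)%:E| = 0)%E.
  by rewrite -[RHS]I0; apply: eq_integral => x _; rewrite gee0_abs// lee_fin sqr_ge0.
move=> /(_ erefl); apply: filterS => x /= /(_ I) [] /eqP.
by rewrite sqrf_eq0 => /eqP.
Qed.

Lemma keeps_sign_ae_eq u w : {ae mu, forall x, u x = w x} ->
  keeps_sign w -> keeps_sign u.
Proof.
by move=> uw [] h; [left|right]; apply: filterS2 uw h => x ->.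
Qed.

Lemma kernel_form_keeps_sign k u : measurable_fun setT k -> (forall z, 0 <= k z) ->
  measurable_fun setT u -> keeps_sign u ->
  kernel_form k (fun x => `|u x|) (fun x => `|u x|) = kernel_form k u u.
Proof.
move=> mk k0 mu_ [] h.
  apply: kernel_form_ae_eq => //; first exact: measurableT_comp.
  by apply: filterS h => x; exact: ger0_norm.
rewrite -[RHS]kernel_form_opp; apply: kernel_form_ae_eq => //.
- exact: measurableT_comp.
- exact: measurableT_comp.
- by apply: filterS h => x; exact: ler0_norm.
Qed.

End kernel_comparison.

(** * The kernels of order s + Log *)

Section kernels.
Context {R : realType} {n : nat}.
Variable s : R.
Notation V := ('rV[R]_n).
Notation mu := (lebesgue_rV R n).

Lemma measurable_kers : measurable_fun setT (@kers R n s).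
Proof.
apply: (@measurableT_comp _ _ _ _ _ _ (fun t => t `^ _)) => //.
exact: measurable_enorm.
Qed.

Let measurable_ln_enorm : measurable_fun setT (fun z : V => - ln (enorm z)).
Proof.
apply: measurableT_comp => //.
apply: (@measurableT_comp _ _ _ _ _ _ (@ln R)) => //.
exact: measurable_enorm.
Qed.

Lemma measurable_kerp : measurable_fun setT (@kerp R n s).
Proof.
apply: measurable_funM; first by apply: measurable_funM => //; exact: measurable_kers.
by apply: measurable_maxr => //; exact: measurable_ln_enorm.
Qed.

Lemma measurable_kerm : measurable_fun setT (@kerm R n s).
Proof.
apply: measurable_funM; first by apply: measurable_funM => //; exact: measurable_kers.
by apply: measurable_maxr => //; apply: measurableT_comp => //; exact: measurable_ln_enorm.
Qed.

Lemma measurable_far (d : R) : measurable_fun setT (fun z : V => (d < enorm z)%R%:R : R).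
Proof.
rewrite (_ : (fun z => _) = \1_(@enorm R n @^-1` `]d, +oo[)).
  apply: measurable_indic.
  by rewrite -[X in measurable X]setTI; exact: measurable_enorm.
apply/funext => z; rewrite indicE; congr ((nat_of_bool _)%:R).
by apply/idP/idP => [h|/set_mem/=]; [apply/mem_set|]; rewrite /= in_itv/= ?h ?andbT.
Qed.

Lemma kers_ge0 (z : V) : 0 <= kers s z.
Proof. exact: powR_ge0. Qed.

Lemma pos_part_ge0 (a : R) : 0 <= pos_part a.
Proof. by rewrite /pos_part le_max lexx. Qed.

Lemma neg_part_ge0 (a : R) : 0 <= neg_part a.
Proof. by rewrite /neg_part le_max lexx. Qed.

Hypothesis c0 : 0 < cns n s.

Lemma kerp_ge0 (z : V) : 0 <= kerp s z.
Proof. by rewrite mulr_ge0 ?pos_part_ge0// mulr_ge0 ?kers_ge0// ltW. Qed.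

Lemma kerm_ge0 (z : V) : 0 <= kerm s z.
Proof. by rewrite mulr_ge0 ?neg_part_ge0// mulr_ge0 ?kers_ge0// ltW. Qed.

Lemma kerm_neq0 (z : V) : kerm s z != 0 -> 1 < enorm z.
Proof.
rewrite /kerm /neg_part opprK; apply: contraNT; rewrite -leNgt => z1.
by rewrite max_l ?mulr0// ln_le0.
Qed.

Lemma kerp_gt0 (z : V) : z != 0 -> enorm z < 1 -> 0 < kerp s z.
Proof.
move=> z0 z1; have ez0 : 0 < enorm z by rewrite lt0r enorm_eq0 z0 enorm_ge0.
rewrite /kerp mulr_gt0//; first by rewrite mulr_gt0// powR_gt0.
by rewrite /pos_part lt_max oppr_gt0 ln_lt0 ?orbT// ez0.
Qed.

(** For [|z| <= 1/e] the logarithm [-ln |z|] is at least [1], so that [k_+]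
dominates [c |z|^(-n-2s)]. *)
Lemma kers_le_kerp_far (n0 : (0 < n)%N) (s0 : 0 < s) (z : V) :
  kers s z <= (cns n s)^-1 * kerp s z + kers s z * (expR (- 1) < enorm z)%R%:R.
Proof.
rewrite (_ : _^-1 * _ = kers s z * pos_part (- ln (enorm z))); last first.
  by rewrite /kerp; field; rewrite gt_eqF.
have [z1|z1] := ltP (expR (-1)) (enorm z).
  by rewrite mulr1 lerDr mulr_ge0 ?kers_ge0// pos_part_ge0.
rewrite mulr0 addr0.
have [->|z0] := eqVneq z 0.
  rewrite /kers (_ : enorm 0 = 0); last by apply/eqP; rewrite enorm_eq0.
  rewrite powR0 ?mul0r// -opprD oppr_eq0 gt_eqF// addr_gt0 ?mulr_gt0//.
  by rewrite ltr0n.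
have ez0 : 0 < enorm z by rewrite lt0r enorm_eq0 z0 enorm_ge0.
rewrite ler_peMr ?kers_ge0// /pos_part le_max; apply/orP; right.
by rewrite lerNr -(expRK (-1)) ler_ln ?posrE// expR_gt0.
Qed.

(** Near the diagonal [E_s] is controlled by [E_+], and away from it the kernel
is integrable. *)
Lemma Es_fin_num (n0 : (0 < n)%N) (s0 : 0 < s) (u : V -> R) : measurable_fun setT u ->
  (\int[mu]_x (u x ^+ 2)%:E < +oo)%E -> (Ep s u u < +oo)%E ->
  Es s u u \is a fin_num.
Proof.
move=> mu_ u2 epu.
have I0 : (0 <= \int[mu]_x (u x ^+ 2)%:E)%E.
  by apply: integral_ge0 => x _; rewrite lee_fin sqr_ge0.
have cV0 : 0 <= (cns n s)^-1 by rewrite invr_ge0 ltW.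
have mkf : measurable_fun setT (fun z : V => kers s z * (expR (- 1) < enorm z)%R%:R).
  by apply: measurable_funM; [exact: measurable_kers|exact: measurable_far].
have kf0 (z : V) : 0 <= kers s z * (expR (- 1) < enorm z)%R%:R.
  by rewrite mulr_ge0 ?kers_ge0.
rewrite ge0_fin_numE; last first.
  by apply: kernel_form_ge0 => z; exact: kers_ge0.
apply: (@le_lt_trans _ _ (kernel_form (fun z : V => (cns n s)^-1 * kerp s z +
    kers s z * (expR (- 1) < enorm z)%R%:R) u u)).
  apply: kernel_form_le_kernel => //.
  - exact: measurable_kers.
  - exact: kers_ge0.
  - apply: measurable_funD => //; apply: measurable_funM => //; exact: measurable_kerp.
  - exact: kers_le_kerp_far.
rewrite kernel_form_kernelDZ//; last 2 first.
- exact: measurable_kerp.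
- exact: kerp_ge0.
apply: lte_add_pinfty.
  by rewrite lte_mul_pinfty.
apply: le_lt_trans (kernel_form_le_L2 _ _ mkf kf0 _ mu_) _.
rewrite lte_mul_pinfty// lte_mul_pinfty//.
  by rewrite ge0_fin_numE.
exact: integral_kers_far.
Qed.

End kernels.

(** * Functions supported in a bounded open set *)

Section supported.
Context {R : realType} {n : nat}.
Notation V := ('rV[R]_n).
Notation mu := (lebesgue_rV R n).
Variables (s : R) (Omega : set V).
Hypotheses (n0 : (0 < n)%N) (s0 : 0 < s) (s1 : s < 1).
Hypotheses (bO : bounded_set Omega) (oO : open Omega) (neO : Omega !=set0).

Let c0 : 0 < cns n s. Proof. exact: cns_gt0. Qed.
Notation d := (diam Omega).
Let d0 : 0 < d. Proof. exact: diam_gt0. Qed.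
Notation sg := (sphere_area R n).

(** The three forms and the L2 norm only depend on the class of [u] modulo null
sets.  A representative that vanishes everywhere off [Omega] makes the estimates
below pointwise. *)
Lemma exists_supported_representative (u : V -> R) : u \in Lfun mu 2%:E ->
  {ae mu, forall x, ~ Omega x -> u x = 0} ->
  exists w : V -> R, [/\ measurable_fun setT w, {ae mu, forall x, u x = w x},
    forall x, ~ Omega x -> w x = 0 &
    exists2 N : R, 0 <= N & (\int[mu]_x (w x ^+ 2)%:E = N%:E)%E /\
      (L2norm Omega u ^+ 2 = N%:E)%E].
Proof.
move=> u2 u0; exists (u \_ Omega).
have mu_ := Lfun2_measurable u u2.
have mw : measurable_fun setT (u \_ Omega).
  apply/(measurable_restrictT _ _).1; first exact: open_measurable_rV.
  exact: measurable_funS mu_.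
have I0 : (0 <= \int[mu]_x ((u \_ Omega) x ^+ 2)%:E)%E.
  by apply: integral_ge0 => x _; rewrite lee_fin sqr_ge0.
have Ioo : (\int[mu]_x ((u \_ Omega) x ^+ 2)%:E < +oo)%E.
  apply: le_lt_trans (Lfun2_sqr_lty u u2); apply: ge0_le_integral => //.
  - by move=> x _; rewrite lee_fin sqr_ge0.
  - by apply/measurable_EFinP; exact: measurable_funX.
  - by apply/measurable_EFinP; exact: measurable_funX.
  - move=> x _; rewrite lee_fin patchE; case: ifP => // _.
    by rewrite expr0n sqr_ge0.
split => //.
- apply: filterS u0 => x h; rewrite patchE; case: ifPn => // /negP xO.
  by apply: h => Ox; apply: xO; exact/mem_set.
- by move=> x nOx; rewrite patchE memNset.
- exists (fine (\int[mu]_x ((u \_ Omega) x ^+ 2)%:E)%E); first exact: fine_ge0.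
  by rewrite L2norm_sqr fineK// ge0_fin_numE.
Qed.

Section fixed_function.
Variables (w : V -> R) (N : R).
Hypotheses (mw : measurable_fun setT w) (w0 : forall x, ~ Omega x -> w x = 0).
Hypotheses (N0 : 0 <= N) (wN : (\int[mu]_x (w x ^+ 2)%:E = N%:E)%E).

Lemma Em_le_L2 :
  (Em s w w <= ((s ^+ 2)^-1 * cns n s * sg * N)%:E)%E.
Proof.
apply: le_trans (kernel_form_le_L2 _ _ (measurable_kerm s) (kerm_ge0 s c0) _ mw) _.
rewrite wN (integral_kerm n s n0 s0 (ltW c0)) -!EFinM lee_fin le_eqVlt.
by apply/orP; left; apply/eqP; field; rewrite gt_eqF.
Qed.

Lemma supported_mul0 x y : d < enorm (x - y) -> w x * w y = 0.
Proof.
move=> dxy; have [Ox|/w0 ->] := pselect (Omega x); last by rewrite mul0r.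
have [Oy|/w0 ->] := pselect (Omega y); last by rewrite mulr0.
by move: dxy; rewrite ltNge diam_ub.
Qed.

(** [k_-] lives on [|z| > 1], where the cross term vanishes. *)
Lemma EmE : d < 1 -> Em s w w = (2 * N * (cns n s * sg / (4 * s ^+ 2)))%:E.
Proof.
move=> d1; rewrite [LHS](kernel_form_eq_L2 _ _ (measurable_kerm s) (kerm_ge0 s c0))//.
  by rewrite wN (integral_kerm n s n0 s0 (ltW c0)) -!EFinM mulrA.
by move=> x y /kerm_neq0 h; apply: supported_mul0; exact: lt_trans h.
Qed.

(** Discard the pairs with [|x - y| <= d]; the cross term vanishes on the others. *)
Lemma Ep_ge : d < 1 ->
  ((2 * N * (cns n s * sg * ((4 * s ^+ 2)^-1 -
      d `^ (- (2 * s)) * (ln d / (2 * s) + (4 * s ^+ 2)^-1))))%:E <= Ep s w w)%E.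
Proof.
move=> d1.
pose k (z : V) : R := kerp s z * (d < enorm z)%R%:R.
have mk : measurable_fun setT k.
  by apply: measurable_funM; [exact: measurable_kerp|exact: measurable_far].
have k0 z : 0 <= k z by rewrite mulr_ge0 ?kerp_ge0.
apply: (@le_trans _ _ (kernel_form k w w)); last first.
  apply: kernel_form_le_kernel => //; first exact: measurable_kerp.
  by move=> z; rewrite ler_piMr ?kerp_ge0// lern1 leq_b1.
rewrite (kernel_form_eq_L2 _ _ mk k0)//.
  by rewrite wN /k (integral_kerp_far n s n0 s0 d (ltW c0)) ?d0// -!EFinM lee_fin -[2 * N * _]mulrA.
move=> x y; rewrite /k; case: ltP => [h _|_]; last by rewrite mulr0 eqxx.
exact: supported_mul0.
Qed.

(** The constant of the lower bound for [E_+ - E_-], that is [2] times the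
difference of [\int_{|z|>d} k_+] and [\int k_-]. *)
Definition gap : R :=
  s^-1 * cns n s * sg * d `^ (- (2 * s)) * (ln d^-1 - (2 * s)^-1).

Lemma Ep_sub_Em_ge : d < 1 -> ((gap * N)%:E <= Ep s w w - Em s w w)%E.
Proof.
move=> d1; rewrite EmE// leeBrDr//.
apply: le_trans (Ep_ge d1); rewrite -EFinD lee_fin le_eqVlt.
by apply/orP; left; apply/eqP; rewrite /gap lnV ?posrE//; field; rewrite gt_eqF.
Qed.

End fixed_function.
End supported.

(** * The estimates on the function space *)

Section main.
Context {R : realType} {n : nat}.
Notation V := ('rV[R]_n).
Notation mu := (lebesgue_rV R n).
Variables (s : R) (Omega : set V).
Hypotheses (n0 : (0 < n)%N) (s0 : 0 < s) (s1 : s < 1).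
Hypotheses (bO : bounded_set Omega) (oO : open Omega) (neO : Omega !=set0).
Notation d := (diam Omega).

Let c0 : 0 < cns n s. Proof. exact: cns_gt0. Qed.
Let d0 : 0 < d. Proof. exact: diam_gt0. Qed.
Let kp0 := @kerp_ge0 R n s c0.
Let km0 := @kerm_ge0 R n s c0.
Let ks0 := @kers_ge0 R n s.
Let mkp := @measurable_kerp R n s.
Let mkm := @measurable_kerm R n s.
Let mks := @measurable_kers R n s.

Lemma sphere_area_gt0 : 0 < sphere_area R n.
Proof. by rewrite sphere_areaE// mulr_gt0 ?ltr0n// ball_volume_gt0. Qed.

Lemma small_diam : d < expR (- (2 * s)^-1) -> d < 1.
Proof.
move=> h; apply: (lt_le_trans h).
by rewrite -[leRHS]expR0 ler_expR oppr_le0 invr_ge0 mulr_ge0// ltW.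
Qed.

Let gap_factor_gt0 :
  0 < s^-1 * cns n s * sphere_area R n * d `^ (- (2 * s)).
Proof.
apply: mulr_gt0; last exact: powR_gt0.
apply: mulr_gt0; last exact: sphere_area_gt0.
by apply: mulr_gt0; rewrite ?invr_gt0.
Qed.

Lemma gap_ge0 : d <= expR (- (2 * s)^-1) -> 0 <= gap s Omega.
Proof.
move=> h; apply: mulr_ge0; first exact: ltW.
by rewrite subr_ge0 lnV ?posrE// lerNr -[leRHS]expRK ler_ln ?posrE ?expR_gt0.
Qed.

Lemma gap_gt0 : d < expR (- (2 * s)^-1) -> 0 < gap s Omega.
Proof.
move=> h; apply: mulr_gt0 => //.
by rewrite subr_gt0 lnV ?posrE// ltrNr -[ltRHS]expRK ltr_ln ?posrE ?expR_gt0.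
Qed.

Lemma Em_le_L2norm (u : V -> R) : L2 Omega u ->
  (0 <= Em s u u)%E /\
  (Em s u u <=
    ((s ^+ 2)^-1 * cns n s * sphere_area R n)%:E * L2norm Omega u ^+ 2)%E.
Proof.
move=> [u2 u0]; split; first exact: kernel_form_ge0.
have mu_ := Lfun2_measurable u u2.
have [w [mw uw w0 [N N0 [wN ->]]]] := exists_supported_representative Omega oO u u2 u0.
rewrite [Em s u u](kernel_form_ae_eq _ _ mkm km0 u w)// -EFinM.
exact: Em_le_L2.
Qed.

Lemma Ep_sub_Em_ge_L2norm (u : V -> R) : d < 1 -> HsLog0 s Omega u ->
  ((gap s Omega)%:E * L2norm Omega u ^+ 2 <= Ep s u u - Em s u u)%E.
Proof.
move=> d1 [u2 _ u0].
have mu_ := Lfun2_measurable u u2.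
have [w [mw uw w0 [N N0 [wN ->]]]] := exists_supported_representative Omega oO u u2 u0.
rewrite [Em s u u](kernel_form_ae_eq _ _ mkm km0 u w)//.
rewrite [Ep s u u](kernel_form_ae_eq _ _ mkp kp0 u w)// -EFinM.
exact: Ep_sub_Em_ge.
Qed.

Lemma L2norm_sqr_ge0 (u : V -> R) : (0 <= L2norm Omega u ^+ 2)%E.
Proof. by rewrite L2norm_sqr integral_ge0// => x _; rewrite lee_fin sqr_ge0. Qed.

Lemma Em_fin (u : V -> R) : L2 Omega u -> Em s u u \is a fin_num.
Proof.
move=> u2; have [? h] := Em_le_L2norm u u2; rewrite ge0_fin_numE//.
move: u2 h => [u2 u0].
have [w [_ _ _ [N _ [_ ->]]]] := exists_supported_representative Omega oO u u2 u0.
by move=> /le_lt_trans; apply; rewrite -EFinM ltry.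
Qed.

Lemma EsLog_positive_definite : d < expR (- (2 * s)^-1) -> 0 <= bns n s ->
  positive_definite_on (HsLog0 s Omega) (fun u => EsLog s u u).
Proof.
move=> dlt b0 u Hu unz.
have d1 := small_diam dlt.
have := Ep_sub_Em_ge_L2norm u d1 Hu; case: (Hu) => u2 _ u0.
have mu_ := Lfun2_measurable u u2.
have [w [mw uw w0 [N N0 [wN ->]]]] := exists_supported_representative Omega oO u u2 u0.
have {N0}N0 : 0 < N.
  rewrite lt_neqAle N0 andbT; apply/eqP => N00; apply: unz.
  move: wN; rewrite -N00 => /(integral_sqr_eq0 _ mw).
  by apply: filterS2 uw => x -> ->.
move=> h; apply: (lt_le_trans (_ : 0 < (gap s Omega)%:E * N%:E)%E).
  by rewrite -EFinM lte_fin mulr_gt0// gap_gt0.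
apply: (le_trans h); rewrite /EsLog leeDl// mule_ge0 ?kernel_form_ge0//.
by rewrite lee_fin; exact: divr_ge0 (mulr_ge0 b0 (ltW c0)) (ler0n _ 2).
Qed.

Lemma abs_HsLog0 (u : V -> R) : HsLog0 s Omega u -> HsLog0 s Omega (fun x => `|u x|).
Proof.
move=> [u2 epu u0].
have mu_ := Lfun2_measurable u u2.
split.
- move: u2; rewrite !inE => /andP[_]; rewrite inE/= => h; apply/andP; split.
    by rewrite inE/=; exact: measurableT_comp.
  rewrite inE/= /finite_norm (_ : _ \o _ = abse \o (EFin \o u)) ?Lnorm_abse//.
- apply: le_lt_trans epu; exact: kernel_form_abs_le.
- by apply: filterS u0 => x h /h ->; rewrite normr0.
Qed.

(** For a function supported in a set of diameter less than [1], [E_-] is a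
multiple of [|u|_2^2]. *)
Lemma Em_abs (u : V -> R) : d < 1 -> HsLog0 s Omega u ->
  Em s (fun x => `|u x|) (fun x => `|u x|) = Em s u u.
Proof.
move=> d1 [u2 _ u0].
have mu_ := Lfun2_measurable u u2.
have [w [mw uw w0 _]] := exists_supported_representative Omega oO u u2 u0.
have ma (f : V -> R) : measurable_fun setT f -> measurable_fun setT (fun x => `|f x|).
  by move=> mf; exact: measurableT_comp.
rewrite [RHS](kernel_form_ae_eq _ _ mkm km0 u w)//.
rewrite [LHS](kernel_form_ae_eq _ _ mkm km0 _ (fun x => `|w x|)); last 3 first.
- exact: ma.
- exact: ma.
- by apply: filterS uw => x ->.
have ww x y : kerm s (x - y) != 0 -> w x * w y = 0.
  by move=> /kerm_neq0 h; apply: supported_mul0 w0 _ _ _ => //; exact: lt_trans h.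
rewrite !kernel_form_eq_L2//.
- by under eq_integral do rewrite real_normK ?num_real//.
- exact: ma.
- by move=> x y /ww; rewrite -normrM => ->; rewrite normr0.
Qed.

(** All the terms being finite, equality of the sums forces equality in each of
the two inequalities [E_+(|u|,|u|) <= E_+(u,u)] and [b_{n,s} E_s(|u|,|u|) <= b_{n,s} E_s(u,u)];
the first one determines the sign. *)
Lemma EsLog_abs (u : V -> R) : d < expR (- (2 * s)^-1) -> 0 <= bns n s ->
  HsLog0 s Omega u ->
  let absu := fun x => `|u x| in
  (EsLog s absu absu <= EsLog s u u)%E /\
  (EsLog s absu absu = EsLog s u u <-> keeps_sign u).
Proof.
move=> dlt b0 Hu absu.
have d1 := small_diam dlt.
have Ha : HsLog0 s Omega absu := abs_HsLog0 u Hu.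
have [u2 epu u0] := Hu; have [a2 epa a0] := Ha.
have mu_ := Lfun2_measurable u u2; have ma := Lfun2_measurable absu a2.
have q0 : 0 <= bns n s * cns n s / 2 by exact: divr_ge0 (mulr_ge0 b0 (ltW c0)) (ler0n _ 2).
rewrite /EsLog (Em_abs u d1 Hu).
have pfin (f : V -> R) : measurable_fun setT f -> (Ep s f f < +oo)%E -> Ep s f f \is a fin_num.
  by move=> mf ?; rewrite ge0_fin_numE// kernel_form_ge0.
have Epa : (Ep s absu absu <= Ep s u u)%E by exact: kernel_form_abs_le.
have Esa : (Es s absu absu <= Es s u u)%E by exact: kernel_form_abs_le.
have fEm : Em s u u \is a fin_num by exact: Em_fin.
have fEs : Es s u u \is a fin_num by apply: Es_fin_num => //; exact: Lfun2_sqr_lty.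
have fEsa : Es s absu absu \is a fin_num by apply: Es_fin_num => //; exact: Lfun2_sqr_lty.
have fEp := pfin u mu_ epu; have fEpa := pfin absu ma epa.
split.
  by apply: leeD; [exact: leeB|exact: lee_wpmul2l].
split=> [eqE|sgn].
  have eqp : Ep s absu absu = Ep s u u.
    move: eqE Epa Esa; rewrite -(fineK fEm) -(fineK fEs) -(fineK fEsa) -(fineK fEp) -(fineK fEpa).
    rewrite -!EFinM -!EFinB -!EFinD !lee_fin => -[] e1 e2 e3; congr EFin.
    have := ler_wpM2l q0 e3; move: e1 e2.
    lra.
  have [w [mw uw w0 _]] := exists_supported_representative Omega oO u u2 u0.
  apply: (keeps_sign_ae_eq u w uw).
  have kE : kernel_form (kerp s) u u = kernel_form (kerp s) w w.
    exact: (kernel_form_ae_eq _ _ mkp kp0 _ _ mu_ mw uw).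
  apply: (kernel_form_abs_eq_sign (kerp s)) => //.
  - by rewrite -kE.
  - move=> x y wx wy.
    have Ox : Omega x by apply: contrapT => /w0 e; move: wx; rewrite e ltxx.
    have Oy : Omega y by apply: contrapT => /w0 e; move: wy; rewrite e ltxx.
    apply: kerp_gt0 => //.
      rewrite subr_eq0; apply/eqP => xy; move: wx; rewrite xy => /lt_trans/(_ wy).
      by rewrite ltxx.
    by apply: le_lt_trans d1; exact: diam_ub.
  - rewrite -kE -[RHS]eqp; apply/esym.
    apply: (kernel_form_ae_eq _ _ mkp kp0) => //; first exact: measurableT_comp.
    by apply: filterS uw => x; rewrite /absu => ->.
by congr (_ - _ + _ * _)%E; exact: kernel_form_keeps_sign.
Qed.

End main.

Theorem proposition1p5 (R : realType) (n : nat) (s : R) (Omega : set 'rV[R]_n)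
    (n_ge1 : (1 <= n)%N) (s_gt0 : 0 < s) (s_lt1 : s < 1)
    (bdd : bounded_set Omega) (lip : lipschitz_domain Omega) :
  [/\
    forall u : 'rV[R]_n -> R, L2 Omega u ->
      (0 <= Em s u u)%E /\
      (Em s u u <=
        ((s ^+ 2)^-1 * cns n s * sphere_area R n)%:E * L2norm Omega u ^+ 2)%E,
    diam Omega < 1 ->
      forall u : 'rV[R]_n -> R, HsLog0 s Omega u ->
        (((s^-1 * cns n s * sphere_area R n * diam Omega `^ (- (2 * s)) *
           (ln (diam Omega)^-1 - (2 * s)^-1))%:E * L2norm Omega u ^+ 2
          <= Ep s u u - Em s u u)%E /\
        (diam Omega <= expR (- (2 * s)^-1) -> (0 <= Ep s u u - Em s u u)%E)) &
    diam Omega < expR (- (2 * s)^-1) -> 0 <= bns n s ->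
      positive_definite_on (HsLog0 s Omega) (fun u => EsLog s u u) /\
      (forall u : 'rV[R]_n -> R, HsLog0 s Omega u ->
        let absu := fun x => `|u x| in
        [/\ HsLog0 s Omega absu,
            (EsLog s absu absu <= EsLog s u u)%E &
            EsLog s absu absu = EsLog s u u <-> keeps_sign u])].
Proof.
have [neO oO _ _] := lip.
split.
- by move=> u; exact: Em_le_L2norm.
- move=> d1 u Hu; have h := Ep_sub_Em_ge_L2norm s Omega n_ge1 s_gt0 s_lt1 bdd oO neO u d1 Hu.
  split; first exact: h.
  move=> dle; apply: le_trans h; rewrite mule_ge0 ?L2norm_sqr_ge0// lee_fin.
  exact: gap_ge0.
- move=> dlt b0; split; first exact: EsLog_positive_definite.
  move=> u Hu absu.
  have [le_abs eq_abs] :=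
    EsLog_abs s Omega n_ge1 s_gt0 s_lt1 bdd oO u dlt b0 Hu.
  by split => //; exact: abs_HsLog0.
Qed.
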